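(* Let $X\subset\mathbb{P}^d$ be a real subvariety of pure codimension $\ell\ge1$ which is hyperbolic with respect to a real $(\ell-1)$-dimensional linear subspace $V\subset\mathbb{P}^d$. Let $Y\subset\mathbb{G}(\ell-1,d)$ be the hypersurface associated to $X$, and let $C(V)$ be the connected component of $V$ in $\mathbb{G}(\ell-1,d)(\mathbb{R})\setminus Y(\mathbb{R})$. Then $X$ is hyperbolic with respect to every $V'\in C(V)$.
   Context: Varieties are over $\mathbb{C}$, reduced, of pure dimension. $\mathbb{G}(m,d)$ is the Grassmannian of $m$-dimensional (projective) linear subspaces of $\mathbb{P}^d$; $\mathbb{G}(m,d)(\mathbb{R})$ is its set of real points with the classical topology. A real subvariety $X\subset\mathbb{P}^d$ of codimension $\ell$ is hyperbolic with respect to a real $(\ell-1)$-dimensional linear subspace $V\subset\mathbb{P}^d$ if $V\cap X=\emptyset$ and for every real $\ell$-dimensional linear subspace $U\supset V$ one has $X\cap U\subset X(\mathbb{R})$. The hypersurface associated to $X$ is $Y=\{V'\in\mathbb{G}(\ell-1,d): V'\cap X\ne\emptyset\}$. *)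

(* Defs.v *)
From HB Require Import structures.
From mathcomp Require Import all_boot all_order all_algebra.
From mathcomp Require Import complex.
From mathcomp Require mpoly.
From mathcomp Require Import all_classical all_reals all_analysis.

Set Implicit Arguments.
Unset Strict Implicit.
Unset Printing Implicit Defensive.

Import Order.TTheory GRing.Theory Num.Theory.
Import numFieldNormedType.Exports.
(* The notations of [mpoly] are incompatible with those of MathComp-Analysis. *)
Import -(notations) mpoly.

Local Open Scope classical_set_scope.
Local Open Scope ring_scope.

(* ['G[K](m, d)]: the [m]-dimensional projective linear subspaces of the
   projective [d]-space over [K], that is, the linear subspaces of dimension
   [m.+1] of [K^(d.+1)].                                                      *)
Record grass (K : fieldType) (m d : nat) := Grass {
  grass_vs :> {vspace 'rV[K]_d.+1};
  grass_dim : \dim grass_vs == m.+1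
}.

Notation "''G[' K ]( m , d )" := (grass K m d)
  (at level 8, K, m, d at level 2, format "''G[' K ]( m ,  d )") : type_scope.

(* Projective space: points are lines through the origin. *)
Notation "''P[' K ]_ d" := (grass K 0 d)
  (at level 8, K at level 2, d at level 2, format "''P[' K ]_ d") : type_scope.

Definition frame (K : fieldType) (m d : nat) : set 'M[K]_(m.+1, d.+1) :=
  [set A | row_free A].
Arguments frame : clear implicits.

Section Grassmannian.
Variable K : fieldType.

HB.instance Definition _ m d := [isSub for @grass_vs K m d].

Lemma grass_inj m d : injective (@grass_vs K m d).
Proof. exact: val_inj. Qed.

Definition rowspan k n (A : 'M[K]_(k, n)) : {vspace 'rV[K]_n} :=
  limg (linfun (mulmxr A : 'rV[K]_k -> 'rV[K]_n)).

Lemma memv_rowspan k n (A : 'M[K]_(k, n)) v : (v \in rowspan A) = (v <= A)%MS.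
Proof.
apply/memv_imgP/submxP => [[u _ ->]|[u ->]]; exists u; rewrite ?memvf ?lfunE //=.
Qed.

Lemma dim_rowspan k n (A : 'M[K]_(k, n)) : row_free A -> \dim (rowspan A) = k.
Proof.
move=> fA; rewrite /rowspan limg_dim_eq; first by rewrite dimvf /dim /= mul1n.
suff /eqP -> : lker (linfun (mulmxr A : 'rV[K]_k -> 'rV[K]_n)) == 0%VS.
  by rewrite capv0.
by apply/lker0P => u v; rewrite !lfunE /= => /(row_free_inj fA).
Qed.


Lemma rowspan_subproof m d (A : 'M[K]_(m.+1, d.+1)) :
  row_free A -> \dim (rowspan A) == m.+1.
Proof. by move/dim_rowspan/eqP. Qed.

Definition grass_of m d (A : frame K m d) : 'G[K](m, d) :=
  Grass (rowspan_subproof (set_valP A)).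

Definition basis_mx m d (V : 'G[K](m, d)) : 'M[K]_(m.+1, d.+1) :=
  \matrix_(i < m.+1) (vbasis V)`_i.

Lemma rowspan_basis_mx m d (V : 'G[K](m, d)) :
  rowspan (basis_mx V) = V :> {vspace _}.
Proof.
have szV : size (vbasis V) = m.+1 by rewrite size_tuple (eqP (grass_dim V)).
apply/vspaceP => v; rewrite memv_rowspan; apply/idP/idP.
  case/submxP => u ->; rewrite mulmx_sum_row memv_suml // => i _.
  by rewrite memvZ // rowK vbasis_mem // mem_nth // szV.
move=> /coord_vbasis ->; rewrite summx_sub // => i _; rewrite scalemx_sub //.
have im : (i < m.+1)%N by rewrite -(eqP (grass_dim V)).
by rewrite (_ : _`_i = row (Ordinal im) (basis_mx V)) ?row_sub // rowK.
Qed.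

Lemma basis_mx_free m d (V : 'G[K](m, d)) : row_free (basis_mx V).
Proof.
set A := basis_mx V.
have dimA : \dim (rowspan A) = m.+1.
  by rewrite rowspan_basis_mx; exact/eqP/grass_dim.
rewrite /row_free -[X in _ == X]dimA.
have -> : rowspan A = rowspan (row_base A).
  by apply/vspaceP => v; rewrite !memv_rowspan eq_row_base.
by rewrite dim_rowspan // row_base_free.
Qed.

Definition grass_frame m d (V : 'G[K](m, d)) : frame K m d :=
  exist _ (basis_mx V) (mem_set (basis_mx_free V)).

Lemma grass_frameK m d : cancel (@grass_frame m d) (@grass_of m d).
Proof. by move=> V; apply: grass_inj; rewrite /= rowspan_basis_mx. Qed.

HB.instance Definition _ m d :=
  isQuotient.Build (frame K m d) 'G[K](m, d) (@grass_frameK m d).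

End Grassmannian.

(* The classical topology on the real Grassmannian: the quotient topology of
   the space of matrices of full row rank under [A |-> rowspan A].            *)
HB.instance Definition _ (R : realType) m d :=
  Topological.copy 'G[R](m, d) (quotient_topology 'G[R](m, d)).

Section Complexification.
Variable R : realType.

Lemma complexify_subproof m d (V : 'G[R](m, d)) :
  \dim (rowspan (map_mx (real_complex R) (basis_mx V))) == m.+1.
Proof. by apply: rowspan_subproof; rewrite row_free_map; exact: basis_mx_free. Qed.

(* The complex span of a real subspace. *)
Definition complexify m d (V : 'G[R](m, d)) : 'G[R[i]](m, d) :=
  Grass (complexify_subproof V).

End Complexification.

Section ProjectiveSets.
Variables (K : fieldType) (d : nat).

Definition vanish_at (f : mpoly d.+1 K) (p : 'P[K]_d) : Prop :=
  forall v : 'rV[K]_d.+1, v \in (p : {vspace _}) ->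
    meval (fun i => v ord0 i) f = 0.

Definition homogeneous (f : mpoly d.+1 K) : Prop :=
  exists e : nat, f \is ishomog1 e mdeg.

Definition zero_locus (S : set (mpoly d.+1 K)) : set 'P[K]_d :=
  [set p | forall f, S f -> vanish_at f p].

Definition zariski_closed (Z : set 'P[K]_d) : Prop :=
  exists2 S, S `<=` homogeneous & Z = zero_locus S.

Definition irreducible_closed (Z : set 'P[K]_d) : Prop :=
  [/\ zariski_closed Z, Z !=set0 &
      forall Z1 Z2, zariski_closed Z1 -> zariski_closed Z2 ->
        Z `<=` Z1 `|` Z2 -> Z `<=` Z1 \/ Z `<=` Z2].

Definition irreducible_component (X Z : set 'P[K]_d) : Prop :=
  [/\ irreducible_closed Z, Z `<=` X &
      forall Z', irreducible_closed Z' -> Z' `<=` X -> Z `<=` Z' -> Z' = Z].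

(* A chain [F 0 < F 1 < ... < F n] of irreducible closed subsets of [Z]. *)
Definition irreducible_chain (Z : set 'P[K]_d) (n : nat) : Prop :=
  exists F : nat -> set 'P[K]_d,
    (forall i, (i <= n)%N -> irreducible_closed (F i) /\ F i `<=` Z) /\
    (forall i, (i < n)%N -> F i `<` F i.+1).

(* Krull dimension of [Z] for the Zariski topology. *)
Definition has_dimension (Z : set 'P[K]_d) (n : nat) : Prop :=
  irreducible_chain Z n /\ forall k, irreducible_chain Z k -> (k <= n)%N.

(* The condition on components is vacuous for the empty set. *)
Definition pure_codim (X : set 'P[K]_d) (l : nat) : Prop :=
  exists2 n, (n + l = d)%N &
    forall Z, irreducible_component X Z -> has_dimension Z n.

Definition points m (W : 'G[K](m, d)) : set 'P[K]_d :=
  [set p | (p <= W)%VS].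

(* The associated hypersurface (Chow form locus); for [X] of codimension [l],
   take [m = l - 1].                                                          *)
Definition associated_hypersurface m (X : set 'P[K]_d) : set 'G[K](m, d) :=
  [set W | points W `&` X !=set0].

End ProjectiveSets.

Section Hyperbolicity.
Variables (R : realType) (d : nat).
Implicit Type X : set 'P[R[i]]_d.

Definition real_subvariety X : Prop :=
  exists2 S : set (mpoly d.+1 R), S `<=` @homogeneous R d &
    X = zero_locus [set map_mpoly (real_complex R) f | f in S].

(* [X(R)], as a subset of [X]. *)
Definition real_points X : set 'P[R[i]]_d := X `&` range (@complexify R 0 d).

(* [Z(R)] for a set [Z] of complex subspaces, as a set of real subspaces. *)
Definition real_locus m (Z : set 'G[R[i]](m, d)) : set 'G[R](m, d) :=
  @complexify R m d @^-1` Z.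

(* [X] is understood to be of codimension [l]. *)
Definition hyperbolic_wrt l X (V : 'G[R](l.-1, d)) : Prop :=
  points (complexify V) `&` X = set0 /\
  forall U : 'G[R](l, d), (V <= U)%VS ->
    X `&` points (complexify U) `<=` real_points X.

End Hyperbolicity.
Arguments associated_hypersurface {K d} m X.
Arguments hyperbolic_wrt {R d} l X V.

(* Main.v *)
Require Import Defs.
From HB Require Import structures.
From mathcomp Require Import all_boot all_order all_algebra.
From mathcomp Require Import complex ring.
From mathcomp Require mpoly.
From mathcomp Require Import all_classical all_reals all_analysis.

(** Write [cone X] for the affine cone over [X].  A real subspace [V] is a
    hyperbolicity direction exactly when no point of [cone X] has a nonzero
    real part lying in [V]: a nonzero [v + iw] with [v] in [V] spans, together
    with its conjugate, a plane that meets [V] (lemma [hyperbolicP]).  In this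
    form hyperbolicity depends on a frame of [V] only, and the theorem says
    that it is locally constant on the frames whose complex span avoids [X].

    Near a frame that avoids [X] there is a box of frames that avoid [X], by
    compactness of the sphere ([avoids_near]), and any two frames in a box are
    joined by replacing one row at a time along a segment that stays in the
    box ([hyperbolic_mx_box]).  So it suffices to move a single basis vector
    [e] of [V = <e, N>] to [e'] along a segment avoiding [X].  This is the
    argument of Garding for hyperbolic polynomials ([garding]): a point of the
    cone whose real part is in [<e', N>] but not in [N] can be normalized to
    [-w + i e'], up to [N].  Let [u] run from 0 to 1 and look for the [t] such
    that [i u e - (1 - u) w + t e' + n] is in [cone X] for some [n] in the
    complex span of [N].  For [u > 0] no such [t] is real, since [V] is
    hyperbolic, so the solution [t = i] at [u = 0] continues to a solution in
    the open upper half-plane at [u = 1]; there it contradicts either the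
    hyperbolicity of [V] or the fact that the segment from [e] to [e'] avoids
    [X].

    Following solutions requires that they are the roots of a monic polynomial
    in [t] whose coefficients are polynomials in [u]; then [root_motion]
    applies.  This is where the purity of [X] enters ([line_lift]).  Let [Z] be
    a component of [X] of dimension [n] through the given point, and project
    it from [N] to the projective space of dimension [n + 1].  Projections from
    points outside a closed irreducible set have closed irreducible images and
    keep strict inclusions strict ([prime_cone_shadow], [shadow_proper]), so
    they preserve the length of chains; hence the further projection of [Z]
    from [e'] is onto ([cone_chain_full]).  A closed irreducible cone that
    surjects under projection from an outside point is the zero set of one
    monic polynomial ([monic_equation]); the essential point is that the
    polynomial ring is normal, so that a relation of least degree can be
    divided by its leading coefficient. *)

Set Implicit Arguments.
Unset Strict Implicit.
Unset Printing Implicit Defensive.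

Import Order.TTheory GRing.Theory Num.Theory.
Import numFieldNormedType.Exports.
Import -(notations) mpoly.

Local Open Scope classical_set_scope.
Local Open Scope ring_scope.

(** * Polynomial functions and one distinguished variable *)

Local Notation ev v p := (meval (fun_of_matrix v ord0) p).

Section PolynomialFunctions.

Lemma rmorph_mmap n (R : nzRingType) (S T : comNzRingType) (f : {rmorphism R -> S})
    (g : 'I_n -> S) (phi : {rmorphism S -> T}) (p : mpoly n R) :
  phi (mmap f g p) = mmap (phi \o f) (phi \o g) p.
Proof.
rewrite /mmap rmorph_sum; apply: eq_bigr => k _.
rewrite rmorphM rmorph_prod; congr (_ * _); apply: eq_bigr => i _.
by rewrite rmorphXn.
Qed.

Variable K : numClosedFieldType.

Definition pt m (t : K) (y : 'rV[K]_m) : 'rV[K]_m.+1 := row_mx (t%:M : 'rV_1) y.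

Lemma pt0 m t (y : 'rV[K]_m) : pt t y ord0 ord0 = t.
Proof. by rewrite /pt mxE; case: splitP => // j _; rewrite mxE (ord1 j) eqxx. Qed.

Lemma ptS m t (y : 'rV[K]_m) j : pt t y ord0 (lift ord0 j) = y ord0 j.
Proof.
rewrite /pt mxE; case: splitP => [i|i] /=; first by rewrite ord1.
by rewrite /bump /= !add1n => -[] /val_inj ->.
Qed.

Lemma ptK m (v : 'rV[K]_m.+1) : pt (v ord0 ord0) (\row_j v ord0 (lift ord0 j)) = v.
Proof.
apply/rowP => i; case: (unliftP ord0 i) => [j|] ->; last by rewrite pt0.
by rewrite ptS mxE.
Qed.

Lemma pt_inj m t t' (y y' : 'rV[K]_m) : pt t y = pt t' y' -> t = t' /\ y = y'.
Proof.
move=> e; split; first by rewrite -(pt0 t y) e pt0.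
by apply/rowP => j; rewrite -(ptS t y) e ptS.
Qed.

Lemma ptZ m a t (y : 'rV[K]_m) : a *: pt t y = pt (a * t) (a *: y).
Proof.
apply/rowP => i; rewrite [LHS]mxE; case: (unliftP ord0 i) => [j|] ->.
  by rewrite !ptS mxE.
by rewrite !pt0.
Qed.

Lemma ptD m t t' (y y' : 'rV[K]_m) : pt t y + pt t' y' = pt (t + t') (y + y').
Proof.
apply/rowP => i; rewrite [LHS]mxE; case: (unliftP ord0 i) => [j|] ->.
  by rewrite !ptS mxE.
by rewrite !pt0.
Qed.

Lemma pt00 m : pt 0 0 = 0 :> 'rV[K]_m.+1.
Proof. by rewrite -(scale0r (pt 0 0)) ptZ mul0r scale0r. Qed.

Definition subst_linear m k (M : 'M[K]_(m, k)) (p : mpoly k K) : mpoly m K :=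
  mmap (mpolyC m (R:=K)) (fun j => \sum_i M i j *: mpolyX K (mnm1 i)) p.

HB.instance Definition _ m k (M : 'M[K]_(m, k)) := GRing.RMorphism.copy (subst_linear M) (mmap _ _).

Lemma subst_linearE m k (M : 'M[K]_(m, k)) p (v : 'rV[K]_m) : ev v (subst_linear M p) = ev (v *m M) p.
Proof.
rewrite /subst_linear rmorph_mmap /= /mmap [RHS]mevalE; apply: eq_bigr => c _.
rewrite /= mevalC; congr (_ * _); apply: eq_bigr => i _; congr (_ ^+ _).
rewrite /= raddf_sum mxE; apply: eq_bigr => j _ /=.
by rewrite mevalZ mevalXU mulrC.
Qed.

(** Degree, leading coefficient and division with respect to the first variable
    are those of univariate polynomials over the ring in the other variables. *)
Definition to_poly m : mpoly m.+1 K -> {poly mpoly m K} :=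
  mmap (polyC \o mpolyC m (R:=K)) (fun i => 
   if unlift ord0 i is Some j then (mpolyX K (mnm1 j))%:P else 'X).

HB.instance Definition _ m := GRing.RMorphism.copy (@to_poly m) (mmap _ _).

Definition eval_coefs m (y : 'rV[K]_m) (q : {poly mpoly m K}) : {poly K} :=
  map_poly (meval (y ord0)) q.
HB.instance Definition _ m y := GRing.RMorphism.copy (@eval_coefs m y) (map_poly _).

Lemma to_polyE m p t (y : 'rV[K]_m) : (eval_coefs y (to_poly p)).[t] = ev (pt t y) p.
Proof.
rewrite /to_poly -[LHS]/((horner_eval t \o eval_coefs y) _) rmorph_mmap /= /mmap [RHS]mevalE.
apply: eq_bigr => c _.
rewrite /= /horner_eval /eval_coefs map_polyC hornerC /= mevalC; congr (_ * _).
apply: eq_bigr => i _; congr (_ ^+ _); rewrite /=.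
case: unliftP => [j|] ->; first by rewrite map_polyC hornerC /= mevalXU ptS.
by rewrite map_polyX hornerX pt0.
Qed.

Definition drop_mx m : 'M[K]_(m.+1, m) := \matrix_(i, j) (i == lift ord0 j)%:R.

Lemma pt_drop_mx m t (y : 'rV[K]_m) : pt t y *m drop_mx m = y.
Proof.
apply/rowP => j; rewrite mxE (bigD1 (lift ord0 j)) //= ptS [drop_mx _ _ _]mxE eqxx mulr1.
rewrite big1 ?addr0 // => i ij; rewrite [drop_mx _ _ _]mxE (negbTE ij) mulr0 //.
Qed.

Definition of_poly m (q : {poly mpoly m K}) : mpoly m.+1 K :=
  (map_poly (subst_linear (drop_mx m)) q).[mpolyX K (mnm1 ord0)].

HB.instance Definition _ m := GRing.RMorphism.copy (@of_poly m) 
  (horner_eval _ \o map_poly (subst_linear (drop_mx m))).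

Lemma of_polyE m q t (y : 'rV[K]_m) : ev (pt t y) (of_poly q) = (eval_coefs y q).[t].
Proof.
rewrite /of_poly -horner_map /= mevalXU pt0 /eval_coefs -map_poly_comp; congr (_.[_]).
by apply: eq_map_poly => c /=; rewrite subst_linearE pt_drop_mx.
Qed.

Lemma to_polyK m : cancel (@to_poly m) (@of_poly m).
Proof.
move=> p; rewrite /to_poly rmorph_mmap /= -[X in _ = X]comp_mpoly_id /comp_mpoly.
apply: eq_bigr => c _; rewrite /= /of_poly map_polyC hornerC /= {1}/subst_linear mmapC.
congr (_ * _); apply: eq_bigr => i _; congr (_ ^+ _).
rewrite /= tnth_mktuple; case: unliftP => [j|] ->; last by rewrite map_polyX hornerX.
rewrite map_polyC hornerC /= {1}/subst_linear mmapX mmap1U (bigD1 (lift ord0 j)) //=.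
rewrite mxE eqxx scale1r big1 ?addr0 // => l lj.
by rewrite mxE (negbTE lj) scale0r.
Qed.

(** The natural numbers give infinitely many candidates in [K]. *)
Lemma nonzero_nonroot (q : {poly K}) : q != 0 -> exists2 t, q.[t] != 0 & t != 0.
Proof.
move=> q0; have Xq0 : 'X * q != 0 by rewrite mulf_neq0 ?polyX_eq0.
suff /existsNP[t /negP] : ~ forall t, root ('X * q) t.
  by rewrite rootE hornerM hornerX mulf_eq0 negb_or => /andP[t0 qt]; exists t.
move=> h.
have := max_poly_roots Xq0 (rs := [seq i%:R | i <- iota 0 (size ('X * q))]).
rewrite size_map size_iota ltnn; apply/not_implyP; split; first by apply/allP.
apply/not_implyP; split => //; rewrite map_inj_uniq ?iota_uniq // => i j /eqP.
by rewrite eqr_nat => /eqP.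
Qed.

Lemma ev_neq0 m (p : mpoly m K) : p != 0 -> exists v : 'rV[K]_m, ev v p != 0.
Proof.
elim: m p => [|m IH] p p0.
  by exists 0; move: p0; rewrite (nvar0_mpolyC p) mevalC mpolyC_eq0.
have : to_poly p != 0 by apply: contraNneq p0 => h; rewrite -(to_polyK p) h raddf0.
rewrite -lead_coef_eq0 => /IH[y hy].
have : eval_coefs y (to_poly p) != 0.
  apply: contraNneq hy => h; rewrite /lead_coef -coef_map.
  by rewrite [map_poly _ _]h coef0.
by move=> /nonzero_nonroot[t ht _]; exists (pt t y); rewrite -to_polyE.
Qed.

Lemma ev_inj m (p q : mpoly m K) : (forall v : 'rV[K]_m, ev v p = ev v q) -> p = q.
Proof.
move=> h; apply/eqP; rewrite -subr_eq0; apply/negPn/negP => /ev_neq0[v].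
by rewrite mevalB h subrr eqxx.
Qed.

Lemma eval_coefs_inj m (p q : {poly mpoly m K}) :
  (forall y : 'rV[K]_m, eval_coefs y p = eval_coefs y q) -> p = q.
Proof.
move=> h; apply/polyP => i; apply: ev_inj => y.
by have := congr1 (fun r : {poly K} => r`_i) (h y); rewrite !coef_map.
Qed.

Lemma eval_coefs_eq0 m (p : {poly mpoly m K}) :
  (forall (y : 'rV[K]_m) t, (eval_coefs y p).[t] = 0) -> p = 0.
Proof.
move=> h; apply: eval_coefs_inj => y; rewrite raddf0.
by apply/eqP/negPn/negP => /nonzero_nonroot[t]; rewrite h eqxx.
Qed.

Lemma eval_coefsD m (y : 'rV[K]_m) p q : eval_coefs y (p + q) = eval_coefs y p + eval_coefs y q.
Proof. exact: rmorphD. Qed.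

Lemma eval_coefsB m (y : 'rV[K]_m) p q : eval_coefs y (p - q) = eval_coefs y p - eval_coefs y q.
Proof. exact: rmorphB. Qed.

Lemma eval_coefsM m (y : 'rV[K]_m) p q : eval_coefs y (p * q) = eval_coefs y p * eval_coefs y q.
Proof. exact: rmorphM. Qed.

Lemma eval_coefsZ m (y : 'rV[K]_m) c p : eval_coefs y (c *: p) = ev y c *: eval_coefs y p.
Proof. exact: map_polyZ. Qed.

Lemma eval_coefs_monic m (y : 'rV[K]_m) (p : {poly mpoly m K}) :
  p \is monic -> eval_coefs y p \is monic /\ size (eval_coefs y p) = size p.
Proof.
move=> mp; split; first exact: monic_map.
by rewrite size_map_poly_id0 // (monicP mp) rmorph1 oner_eq0.
Qed.

(** The homogenization of [p] in degree [E], the univariate variable being the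
    homogenizing one.  Its leading coefficient is the constant term of [p], so
    homogenizing in a direction where a polynomial does not vanish makes it
    monic up to a scalar. *)
Definition homogenize m (E : nat) (p : mpoly m K) : {poly mpoly m K} :=
  \sum_(c <- msupp p) (mcoeff c p *: mpolyX K c)%:P * 'X^(E - mdeg c).

Lemma homogenizeE m E p x (y : 'rV[K]_m) : x != 0 -> (msize p <= E)%N ->
  (eval_coefs y (homogenize E p)).[x] = x ^+ E * ev (x^-1 *: y) p.
Proof.
move=> x0 szp; rewrite mevalE rmorph_sum /= horner_sum mulr_sumr.
rewrite big_seq [RHS]big_seq; apply: eq_bigr => c cp.
rewrite rmorphM rmorphXn /= /eval_coefs map_polyC map_polyX /= hornerM hornerC.
rewrite hornerXn mevalZ mevalX mulrCA -!mulrA; congr (_ * _).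
have cE : (mdeg c <= E)%N by rewrite ltnW // (leq_trans _ szp) // msize_mdeg_lt.
under [in RHS]eq_bigr do rewrite mxE exprMn.
rewrite big_split /= mulrA [LHS]mulrC; congr (_ * _).
by rewrite -expr_sum -mdegE exprVn -expfB_cond //= ?(negbTE x0).
Qed.

(** The degree exceeds that of [p], so every term contains the homogenizing
    variable. *)
Lemma homogenize0E m E p (y : 'rV[K]_m) : (msize p <= E)%N -> (eval_coefs y (homogenize E p)).[0] = 0.
Proof.
move=> szp; rewrite rmorph_sum /= horner_sum big1_seq // => c /andP[_ cp].
rewrite rmorphM rmorphXn /= /eval_coefs map_polyC map_polyX /= hornerM hornerXn.
by rewrite expr0n subn_eq0 leqNgt (leq_trans (msize_mdeg_lt cp) szp) mulr0.
Qed.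

Lemma size_homogenize m E (p : mpoly m K) : (msize p <= E)%N -> mcoeff mnm0 p != 0 ->
  size (homogenize E p) = E.+1 /\ lead_coef (homogenize E p) = mpolyC m (mcoeff mnm0 p).
Proof.
move=> szp p0; have p0s : mnm0 \in msupp p by rewrite mcoeff_msupp.
have p0C : mpolyC m (mcoeff mnm0 p) != 0 by rewrite mpolyC_eq0.
rewrite /homogenize (bigD1_seq mnm0) ?msupp_uniq //= mdeg0 subn0 mpolyX0.
have -> : mcoeff mnm0 p *: 1 = mpolyC m (mcoeff mnm0 p) by rewrite alg_mpolyC.
rewrite mul_polyC; set r := \sum_(_ <- _ | _) _.
have szX : size (mpolyC m (mcoeff mnm0 p) *: 'X^E) = E.+1.
  by rewrite size_scale // size_polyXn.
have szr : (size r < size (mpolyC m (mcoeff mnm0 p) *: 'X^E))%N.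
  rewrite szX ltnS (leq_trans (size_sum _ _ _)) //.
  apply/bigmax_leqP_seq => c cp c0.
  rewrite mul_polyC (leq_trans (size_scale_leq _ _)) // size_polyXn.
  have : (0 < mdeg c)%N by rewrite lt0n mdeg_eq0.
  have := leq_trans (msize_mdeg_lt cp) szp.
  by case: (E) => // e _ d0; rewrite ltn_subrL d0.
by rewrite size_polyDl // lead_coefDl // szX lead_coefZ lead_coefXn mulr1.
Qed.

Lemma mcoeff0_ev m (p : mpoly m K) : mcoeff mnm0 p = ev (0 : 'rV[K]_m) p.
Proof.
elim/mpolyind: p => [|c k p _ _ IH]; first by rewrite mcoeff0 meval0.
rewrite mcoeffD mcoeffZ mcoeffX mevalD mevalZ mevalX IH; congr (c * _ + _).
case: eqVneq => [->|k0] /=.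
  by rewrite big1 // => i _; rewrite mnm0E expr0.
have /existsP[i ki] : [exists i, k i != 0%N].
  apply: contraNT k0 => /existsPn h; apply/eqP/mnmP => i; rewrite mnm0E.
  by have := h i; rewrite negbK => /eqP.
by rewrite (bigD1 i) //= mxE expr0n (negbTE ki) mul0r.
Qed.

End PolynomialFunctions.

(** * Closed cones and linear projections *)

Section Cones.
Variable K : numClosedFieldType.

Definition vanishes m (C : set 'rV[K]_m) (p : mpoly m K) := forall v, C v -> ev v p = 0.

(** Projective closed sets are handled through their affine cones, and may
    then be cut out by arbitrary polynomials: those vanishing on a cone form a
    homogeneous ideal. *)
Definition closed_cone m (C : set 'rV[K]_m) :=
  [/\ C 0, forall a v, C v -> C (a *: v) &
   forall v, ~ C v -> exists2 p, vanishes C p & ev v p != 0].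

(** The cone over a nonempty irreducible closed set. *)
Definition prime_cone m (C : set 'rV[K]_m) :=
  [/\ closed_cone C,
      forall p q, vanishes C (p * q) -> vanishes C p \/ vanishes C q &
      exists2 v, C v & v != 0].

Lemma prime_cone_iso m (B : 'M[K]_m) (C : set 'rV[K]_m) : B \in unitmx ->
  prime_cone C -> prime_cone [set v | C (v *m B)].
Proof.
move=> uB [[C0 CZ Cc] Cp [v Cv v0]]; split.
- split=> /=; rewrite ?mul0mx //; first by move=> a w; rewrite -scalemxAl; apply: CZ.
  move=> w /Cc[p Cp' wp]; exists (subst_linear B p); last by rewrite subst_linearE.
  by move=> u /= /Cp'; rewrite subst_linearE.
- have h p : vanishes C (subst_linear (invmx B) p) <-> vanishes [set v | C (v *m B)] p.
    split=> vp w /= Cw; last by rewrite subst_linearE; apply: vp; rewrite /= mulmxKV.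
    by have := vp _ Cw; rewrite subst_linearE mulmxK.
  by move=> p q /h; rewrite rmorphM => /Cp[] /h; [left|right].
- by exists (v *m invmx B); rewrite /= ?mulmxKV // -(mul0mx _ (invmx B)) (inj_eq (can_inj (mulmxKV uB))).
Qed.

(** Over an infinite field, a vector space of polynomials is not a finite union
    of proper subspaces. *)
Lemma closed_cone_avoid m (C : set 'rV[K]_m) (s : seq 'rV[K]_m) : closed_cone C ->
  (forall v, v \in s -> ~ C v) ->
  exists2 p, vanishes C p & forall v, v \in s -> ev v p != 0.
Proof.
move=> [_ _ Cc]; elim: s => [|x s IH] sC; first by exists 0 => // v _; rewrite meval0.
have [p vp ps] := IH (fun v vs => sC v (mem_behead (s := x :: s) vs)).
have [q vq qx] := Cc x (sC x (mem_head _ _)).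
have : \prod_(v <- s) ((ev v p)%:P + (ev v q) *: 'X) * ((ev x p)%:P + (ev x q) *: 'X) != 0.
  rewrite mulf_neq0 //; last first.
    apply: contraNneq qx => /(congr1 (fun r : {poly K} => r`_1)).
    by rewrite coefD coefC coefZ coefX mulr1 coef0 add0r => ->.
  rewrite prodf_seq_neq0; apply/allP => v vs /=; apply: contraNneq (ps v vs).
  move=> /(congr1 (fun r : {poly K} => r`_0)).
  by rewrite coefD coefC coefZ coefX mulr0 coef0 addr0 => ->.
move=> /nonzero_nonroot[a ha _]; exists (p + a *: q).
  by move=> v Cv; rewrite mevalD mevalZ vp ?vq // mulr0 addr0.
move: ha; rewrite hornerM horner_prod mulf_eq0 negb_or => /andP[].
rewrite prodf_seq_neq0 => /allP /= hs hx v; rewrite inE => /predU1P[->|/hs].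
  by move: hx; rewrite hornerD hornerC hornerZ hornerX mevalD mevalZ mulrC.
by rewrite hornerD hornerC hornerZ hornerX mevalD mevalZ mulrC.
Qed.

(** If [h] vanishes on [C] but not at the center, then dehomogenizing [h] at the
    first coordinate and homogenizing again gives a polynomial that still
    vanishes on [C], because [C] is a cone, and whose leading coefficient in
    the first variable is the value of [h] at the center. *)
Lemma monic_relation m (C : set 'rV[K]_m.+1) : closed_cone C -> ~ C (pt 1 0) ->
  exists G : {poly mpoly m K}, [/\ G \is monic, (1 < size G)%N &
    forall t y, C (pt t y) -> (eval_coefs y G).[t] = 0].
Proof.
move=> [C0 CZ Cc] /Cc[h vh h1].
pose p := (to_poly h).[1]; pose E := (msize p).+1.
have evp y : ev y p = ev (pt 1 y) h by rewrite -to_polyE /p -horner_map rmorph1.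
have p0 : mcoeff mnm0 p != 0 by rewrite mcoeff0_ev evp.
have [sh lh] := size_homogenize (leqnSn _ : (msize p <= E)%N) p0.
set c := mcoeff mnm0 p in p0 lh.
have sG : size (mpolyC m c^-1 *: homogenize E p) = E.+1.
  by rewrite size_scale ?sh // mpolyC_eq0 invr_eq0.
exists (mpolyC m c^-1 *: homogenize E p); split.
- by rewrite monicE lead_coefZ lh -mpolyCM mulVf.
- by rewrite sG.
move=> t y Cty; rewrite /eval_coefs map_polyZ hornerZ -/(eval_coefs y _).
have [->|t0] := eqVneq t 0; first by rewrite homogenize0E ?mulr0 // leqnSn.
rewrite homogenizeE ?leqnSn // evp vh ?mulr0 //.
by have := CZ t^-1 _ Cty; rewrite ptZ mulVf.
Qed.

(** [chi] is the characteristic polynomial of the multiplication by [H] modulo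
    [G].  It is an integral equation for [H] where [G] vanishes, and its
    constant term is, up to sign, the product of the values of [H] at the roots
    of [G]. *)
Lemma norm_polynomial m (G H : {poly mpoly m K}) : G \is monic -> (1 < size G)%N ->
  exists2 chi : {poly mpoly m K}, chi \is monic &
    (forall (y : 'rV[K]_m) t, root (eval_coefs y G) t -> root (eval_coefs y chi) (eval_coefs y H).[t]) /\
    (forall y : 'rV[K]_m, (forall t, root (eval_coefs y G) t -> (eval_coefs y H).[t] != 0) ->
       ev y chi`_0 != 0).
Proof.
move=> mG; case sG: (size G) => [|[|e]] // _.
have [A GA] : exists A : 'M[mpoly m K]_e.+1, char_poly A = G.
  have := companionmxK mG; move: (companionmx G); rewrite sG /= => A; by exists A.
pose N := horner_mx A H; exists (char_poly N); first exact: char_poly_monic.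
have evN (y : 'rV[K]_m) : eval_coefs y (char_poly N) = char_poly (horner_mx (map_mx (meval (y ord0)) A) (eval_coefs y H)).
  by rewrite /eval_coefs map_char_poly map_horner_mx.
have evG (y : 'rV[K]_m) : eval_coefs y G = char_poly (map_mx (meval (y ord0)) A).
  by rewrite /eval_coefs -GA map_char_poly.
split=> y.
  move=> t; rewrite evG evN -!eigenvalue_root_char => /eigenvalueP[v vA v0].
  apply/eigenvalueP; exists v => //; move: (map_mx _ A) (eval_coefs y H) vA => B h vB.
  elim/poly_ind: h => [|h c IH]; first by rewrite raddf0 horner0 mulmx0 scale0r.
  rewrite rmorphD rmorphM /= horner_mx_X horner_mx_C mulmxDr mul_mx_scalar mulmxA.
  by rewrite IH -scalemxAl vB hornerMXaddC scalerA scalerDl.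
move=> h; have : coprimep (eval_coefs y G) (eval_coefs y H) by apply: Pdiv.ClosedField.root_coprimep.
rewrite -coef_map [map_poly _ _]evN evG; move: (map_mx _ A) (eval_coefs y H) => B q.
rewrite char_poly_det mulf_eq0 signr_eq0 /= -unitfE => cop.
suff : horner_mx B q \in unitmx by rewrite unitmxE unitfE.
have /Bezout_eq1_coprimepP[[u v] /= uv] := cop.
have := congr1 (horner_mx B) uv; rewrite rmorphD !rmorphM rmorph1 /=.
by rewrite Cayley_Hamilton mulr0 add0r => /mulmx1_unit[].
Qed.

(** The image of [C] under the projection from the first basis vector. *)
Definition shadow m (C : set 'rV[K]_m.+1) : set 'rV[K]_m := [set y | exists t, C (pt t y)].

(** Elimination: a point [y] outside the image has finitely many preimages among
    the zeros of a monic relation, all outside [C]; the norm of a polynomial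
    that vanishes on [C] and at none of them separates [y] from the image. *)
Lemma prime_cone_shadow m (C : set 'rV[K]_m.+1) :
  prime_cone C -> ~ C (pt 1 0) -> prime_cone (shadow C).
Proof.
move=> [clC Cp [v Cv v0]] C1; have [C0 CZ _] := clC.
have [G [mG sG vG]] := monic_relation clC C1.
split; first split.
- by exists 0; rewrite pt00.
- by move=> a y [t Cty]; exists (a * t); rewrite -ptZ; apply: CZ.
- move=> y Cy; have [r /= Gr] := closed_field_poly_normal (eval_coefs y G).
  have [mGy _] := eval_coefs_monic y mG; rewrite (monicP mGy) scale1r in Gr.
  have [p vp yp] := @closed_cone_avoid _ C [seq pt t y | t <- r] clC (fun v =>
     ltac:(by move=> /mapP[t _ ->] Cty; apply: Cy; exists t)).
  have [chi mchi [chi0 chi1]] := norm_polynomial (to_poly p) mG sG.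
  exists chi`_0; last first.
    apply: chi1 => t; rewrite Gr root_prod_XsubC to_polyE => tr; apply: yp.
    exact: map_f.
  move=> z [t Ctz]; have /chi0 : root (eval_coefs z G) t by apply/rootP/vG.
  by rewrite to_polyE vp // => /rootP; rewrite horner_coef0 coef_map.
- move=> p q vpq.
  have h r : vanishes (shadow C) r <-> vanishes C (subst_linear (drop_mx K m) r).
    split=> vr w.
      move=> Cw; rewrite subst_linearE vr // -(ptK w) pt_drop_mx.
      by exists (w ord0 ord0); rewrite ptK.
    by move=> [t /vr]; rewrite subst_linearE pt_drop_mx.
  by move: vpq => /h; rewrite rmorphM => /Cp[] /h; [left|right].
- exists (\row_j v ord0 (lift ord0 j)); first by exists (v ord0 ord0); rewrite ptK.
  apply/eqP => r0; apply: C1.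
  have vE : v = pt (v ord0 ord0) 0 by rewrite -[LHS]ptK r0.
  have vn0 : v ord0 ord0 != 0.
    by apply: contraNneq v0 => w0; rewrite vE w0 pt00.
  have := CZ (v ord0 ord0)^-1 _ Cv; rewrite {2}vE ptZ mulVf // scaler0 //.
Qed.

(** Incomparability: take [h] vanishing on [C1] but not on [C2], and an integral
    equation of [h] on [C2].  If the images were equal, its constant term would
    vanish on [C2], and since [C2] is prime the equation could be divided by
    [h], until nothing is left. *)
Lemma shadow_proper m (C1 C2 : set 'rV[K]_m.+1) : closed_cone C1 -> prime_cone C2 ->
  C1 `<` C2 -> ~ C2 (pt 1 0) -> shadow C1 `<` shadow C2.
Proof.
move=> [_ _ clC1] [clC2 pC2 _] [C12 /existsNP[v /not_implyP[C2v C1v]]] C2q.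
split; first by move=> y [t /C12]; exists t.
have [h vh hv] := clC1 _ C1v => C21.
have [G [mG sG vG]] := monic_relation clC2 C2q.
have [chi mchi [chi0 _]] := norm_polynomial (to_poly h) mG sG.
have : forall t y, C2 (pt t y) -> (eval_coefs y chi).[ev (pt t y) h] = 0.
  by move=> t y C2ty; rewrite -to_polyE; apply/rootP/chi0/rootP/vG.
(* divide the integral equation by [h] as long as possible *)
have [k] : exists k, (size chi <= k)%N by exists (size chi).
elim: k chi mchi {chi0} => [|k IH] chi mchi.
  by rewrite leqn0 size_poly_eq0 (negbTE (monic_neq0 mchi)).
move=> sk vchi.
have v0 : vanishes (shadow C2) chi`_0.
  move=> y /C21[t C1ty].
  by have := vchi _ _ (C12 _ C1ty); rewrite vh // horner_coef0 coef_map.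
have [chi' chiE] : exists chi', chi = chi' * 'X + (chi`_0)%:P.
  elim/poly_ind: chi {mchi sk vchi v0} => [|q c _]; first by exists 0; rewrite coef0 mul0r addr0.
  by exists q; rewrite coefD coefMX coefC add0r.
have chi'0 : chi' != 0.
  apply: contraTneq mchi => c0; apply/negP => mchi.
  rewrite c0 mul0r add0r in chiE.
  have c1 : chi`_0 = 1 by move: (monicP mchi); rewrite {1}chiE lead_coefC.
  have : ev (0 : 'rV[K]_m) chi`_0 = 0.
    by apply: v0; exists 0; rewrite pt00; case: clC2.
  by rewrite c1 rmorph1 => /eqP; rewrite oner_eq0.
have sC : (size (chi`_0)%:P < size (chi' * 'X)%R)%N.
  by rewrite size_mulX // (leq_ltn_trans (size_polyC_leq1 _)) // ltnS lt0n size_poly_eq0.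
apply: (IH chi').
- by move: mchi; rewrite chiE !monicE lead_coefDl // lead_coefMX.
- by move: sk; rewrite chiE size_polyDl // size_mulX.
have : vanishes C2 (h * (map_poly (subst_linear (drop_mx K m)) chi').[h]).
  move=> w C2w; rewrite mevalM -horner_map -map_poly_comp /=.
  have -> : map_poly (meval (w ord0) \o subst_linear (drop_mx K m)) chi' = eval_coefs (w *m drop_mx K m) chi'.
    by apply: eq_map_poly => c /=; rewrite subst_linearE.
  rewrite -[w in w *m _]ptK pt_drop_mx.
  have := vchi (w ord0 ord0) (\row_j w ord0 (lift ord0 j)); rewrite ptK => /(_ C2w).
  rewrite {1}chiE rmorphD rmorphM /= /eval_coefs map_polyX map_polyC hornerD hornerMX hornerC /=.
  rewrite (v0 (\row_j w ord0 (lift ord0 j))) ?addr0; last by exists (w ord0 ord0); rewrite ptK.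
  by rewrite mulrC.
case/pC2 => [vh2|vc]; first by move: hv; rewrite vh2 ?eqxx.
move=> t y C2ty; have := vc _ C2ty; rewrite -horner_map -map_poly_comp /= => <-.
congr (_.[_]); apply: eq_map_poly => c /=; by rewrite subst_linearE pt_drop_mx.
Qed.

Definition cone_img m k (M : 'M[K]_(m, k)) (C : set 'rV[K]_m) : set 'rV[K]_k :=
  [set v *m M | v in C].

Definition onto_mx m k (M : 'M[K]_(m, k)) := forall w : 'rV[K]_k, exists v, v *m M = w.

(** The first row of an extended row basis of [q] is proportional to [q]. *)
Lemma complete_to_basis m (q : 'rV[K]_m.+1) : q != 0 ->
  exists2 B : 'M[K]_m.+1, B \in unitmx & pt 1 0 *m B = q.
Proof.
move=> q0; have c0 : col_ebase q 0 0 != 0.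
  by have := col_ebase_unit q; rewrite {1}[col_ebase q]mx11_scalar unitmxE det_scalar1 unitfE.
exists (col_ebase q 0 0 *: row_ebase q).
  by rewrite unitmxZ ?row_ebase_unit // unitfE.
rewrite -[RHS]mulmx_ebase {2}[col_ebase q]mx11_scalar mul_scalar_mx.
rewrite -scalemxAl -scalemxAr; congr (_ *: (_ *m _)).
have -> : \rank q = 1%N by rewrite rank_rV q0.
apply/rowP => i; rewrite [RHS]mxE; case: (unliftP ord0 i) => [j|] ->.
  by rewrite ptS mxE.
by rewrite pt0.
Qed.

(** A surjective linear map whose kernel meets [C] trivially is a composition of
    projections from points. *)
Lemma prime_cone_img m k (M : 'M[K]_(m, k)) (C : set 'rV[K]_m) : onto_mx M ->
  prime_cone C -> (forall v, C v -> v *m M = 0 -> v = 0) ->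
  prime_cone (cone_img M C) /\
  forall C1, prime_cone C1 -> C1 `<` C -> cone_img M C1 `<` cone_img M C.
Proof.
elim: m k M C => [|m IH] k M C sM pC kC.
  by have [_ _ [v _]] := pC; rewrite [v]thinmx0 eqxx.
have rM : \rank M = k.
  apply/eqP/row_fullP.
  suff /submxP[D] : (1%:M <= M)%MS by move=> D1; exists D.
  apply/row_subP => i; have [v <-] := sM (row i 1%:M); exact: submxMl.
have [km|km] := eqVneq k m.+1.
  subst k; have uM : M \in unitmx by rewrite -row_full_unit /row_full rM.
  have imgE D : cone_img M D = [set v | D (v *m invmx M)].
    apply/seteqP; split => [_ [v Dv <-]|v /= Dv]; first by rewrite /= mulmxK.
    by exists (v *m invmx M); rewrite ?mulmxKV.
  split; first by rewrite imgE; apply: prime_cone_iso; rewrite ?unitmx_inv.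
  move=> C1 _ [C1C CC1]; rewrite !imgE; split => [v /C1C //|h].
  by apply: CC1 => v Cv; have := h (v *m M); rewrite /= mulmxK //; apply.
have /rowV0Pn[q /sub_kermxP qM q0] : kermx M != 0.
  rewrite -mxrank_eq0 mxrank_ker rM subn_eq0 -ltnNge ltn_neqAle km -rM.
  exact: rank_leq_row.
have [B uB Bq] := complete_to_basis q0.
pose M' := row' ord0 (B *m M).
have ptM t y : pt t y *m (B *m M) = y *m M'.
  have -> : pt t y = t *: pt 1 0 + pt 0 y.
    by rewrite ptZ ptD mulr1 addr0 scaler0 add0r.
  rewrite mulmxDl -scalemxAl mulmxA Bq qM scaler0 add0r.
  apply/rowP => j; rewrite !mxE big_ord_recl pt0 mul0r add0r.
  by apply: eq_bigr => i _; rewrite ptS [M' _ _]mxE.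
pose pre (D : set 'rV[K]_m.+1) := [set v | D (v *m B)].
have imgE D : cone_img M D = cone_img M' (shadow (pre D)).
  apply/seteqP; split => [_ [v Dv <-]|_ [y [t Dty] <-]].
    exists (\row_j (v *m invmx B) ord0 (lift ord0 j)).
      by exists ((v *m invmx B) ord0 ord0); rewrite ptK /pre /= mulmxKV.
    by rewrite -(ptM ((v *m invmx B) ord0 ord0)) ptK mulmxA mulmxKV.
  by exists (pt t y *m B); rewrite // -mulmxA ptM.
have pCB : prime_cone (pre C) by exact: prime_cone_iso.
have qC : ~ pre C (pt 1 0).
  by rewrite /pre /= Bq => /kC /(_ qM) /eqP; rewrite (negbTE q0).
have pP := prime_cone_shadow pCB qC.
have [||h1 h2] := IH _ M' _ _ pP.
- move=> w; have [v <-] := sM w; exists (\row_j (v *m invmx B) ord0 (lift ord0 j)).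
  by rewrite -(ptM ((v *m invmx B) ord0 ord0)) ptK mulmxA mulmxKV.
- move=> y [t Cty] yM; have := kC _ Cty; rewrite -mulmxA ptM => /(_ yM).
  rewrite -(mul0mx _ B) => /(can_inj (mulmxK uB)); rewrite -pt00 => /pt_inj[_ //].
rewrite imgE; split => // C1 pC1 [C1C CC1]; rewrite !imgE.
have pC1B : prime_cone (pre C1) by exact: prime_cone_iso.
apply: h2; first by apply: prime_cone_shadow => // /C1C.
apply: shadow_proper => //; first by case: pC1B.
split => [v /C1C //|h]; apply: CC1 => v Cv.
by have := h (v *m invmx B); rewrite /pre /= mulmxKV //; apply.
Qed.

Definition cone_chain m (C : set 'rV[K]_m) n := exists F : nat -> set 'rV[K]_m,
  (forall i, (i <= n)%N -> prime_cone (F i) /\ F i `<=` C) /\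
  (forall i, (i < n)%N -> F i `<` F i.+1).

Lemma cone_chain_img m k (M : 'M[K]_(m, k)) (C : set 'rV[K]_m) n : onto_mx M ->
  (forall v, C v -> v *m M = 0 -> v = 0) -> cone_chain C n -> cone_chain (cone_img M C) n.
Proof.
move=> sM kC [F [F1 F2]]; exists (fun i => cone_img M (F i)); split => i le_in.
  have [pF FC] := F1 i le_in.
  split; last by move=> _ [v /FC Cv <-]; exists v.
  by apply: (prime_cone_img sM pF _).1 => v /FC; apply: kC.
have [pF FC] := F1 i (ltnW le_in); have [pF' FC'] := F1 i.+1 le_in.
by apply: (prime_cone_img sM pF' _).2 (F2 _ le_in) => // v /FC'; apply: kC.
Qed.

Lemma projection_from m (q : 'rV[K]_m.+1) : q != 0 ->
  exists2 M : 'M[K]_(m.+1, m), onto_mx M &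
    forall C : set 'rV[K]_m.+1, (forall a v, C v -> C (a *: v)) -> ~ C q ->
    forall v, C v -> v *m M = 0 -> v = 0.
Proof.
move=> q0; have [B uB Bq] := complete_to_basis q0.
exists (invmx B *m drop_mx K m).
  by move=> w; exists (pt 0 w *m B); rewrite mulmxA mulmxK // pt_drop_mx.
move=> C CZ Cq v Cv; rewrite mulmxA -[v *m _]ptK pt_drop_mx => r0.
set t := (v *m invmx B) ord0 ord0.
have vE : v = t *: q.
  by rewrite -Bq scalemxAl ptZ mulr1 scaler0 -r0 ptK mulmxKV.
have [t0|t0] := eqVneq t 0; first by rewrite vE t0 scale0r.
by case: Cq; have := CZ t^-1 _ Cv; rewrite vE scalerA mulVf // scale1r.
Qed.

(** Without its largest member, the chain lies in a proper closed cone; a point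
    outside of that cone is a center of projection. *)
Lemma cone_chain_lt m (C : set 'rV[K]_m) n : cone_chain C n -> (n < m)%N.
Proof.
elim: m n C => [|m IH] n C [F [F1 F2]].
  have [[_ _ [v _ v0]] _] := F1 0%N (leq0n _).
  by move: v0; rewrite [v]thinmx0 eqxx.
case: n F1 F2 => [//|n] F1 F2.
have [_ /existsNP[q /not_implyP[_ Fq]]] := F2 n (ltnSn _).
have [[[F0 FZ _] _ _] _] := F1 n (leqnSn _).
have q0 : q != 0 by apply/eqP => q0; apply: Fq; rewrite q0.
have [M sM kM] := projection_from q0.
rewrite ltnS; apply: (IH n (cone_img M (F n))); apply: cone_chain_img => //.
  exact: (kM _ FZ Fq).
exists F; split => i le_in; last by apply: F2; rewrite ltnW.
split; first by case: (F1 i (leqW le_in)).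
elim: n le_in {IH Fq F0 FZ F1} F2 => [|n IH].
  by rewrite leqn0 => /eqP -> _; exact: subset_refl.
rewrite leq_eqVlt => /predU1P[-> _|le_in F2]; first exact: subset_refl.
have [h _] := F2 n (leqnSn _); apply: subset_trans h; apply: IH => // j jn.
by apply: F2; rewrite ltnW.
Qed.

Lemma cone_chain_full m (C : set 'rV[K]_m.+1) : closed_cone C -> cone_chain C m -> forall v, C v.
Proof.
move=> [C0 CZ _] ch q; apply: contrapT => Cq.
have q0 : q != 0 by apply/eqP => q0; apply: Cq; rewrite q0.
have [M sM kM] := projection_from q0.
by have /cone_chain_lt := cone_chain_img sM (kM C CZ Cq) ch; rewrite ltnn.
Qed.

End Cones.

(** * Monic equations of cones of codimension one *)

Section MonicEquation.
Variable K : numClosedFieldType.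

(** A form of Gauss's lemma over [K[x]]: a factor of a nonzero scalar multiple of
    a monic polynomial is divisible by its leading coefficient.  Each root of
    the scalar [e] can be cancelled against one of the two factors, because
    evaluation at that root maps to the domain [K[T]]. *)
Lemma lead_coef_dvdp (e : {poly K}) (G q f : {poly {poly K}}) : e != 0 ->
  G \is monic -> e *: G = q * f -> forall i, lead_coef f %| f`_i.
Proof.
have [k] : exists k, (size e <= k)%N by exists (size e).
elim: k e q f => [|k IH] e q f; first by rewrite leqn0 size_poly_eq0 => ->.
move=> sek e0 mG eG; have [/closed_rootP[x ex]|] := boolP (size e != 1%N); last first.
  rewrite negbK => se i; apply: (@dvdp_trans _ e).
    have := congr1 (fun r : {poly {poly K}} => lead_coef r) eG.
    rewrite lead_coefZ (monicP mG) mulr1 lead_coefM => ->.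
    exact: dvdp_mulIr.
  apply: (@dvdp_trans _ 1); last exact: dvd1p.
  by rewrite dvdp1.
have [e' eE] : exists e', e = e' * ('X - x%:P) by apply/factor_theorem.
have e'0 : e' != 0 by apply: contraNneq e0 => h; rewrite eE h mul0r.
have X0 : 'X - x%:P != 0 :> {poly K} by rewrite polyXsubC_eq0.
have XI : injective (fun r : {poly {poly K}} => ('X - x%:P) *: r).
  by move=> r r' /eqP; rewrite -!mul_polyC (inj_eq (mulfI _)) ?polyC_eq0 // => /eqP.
have se' : (size e' <= k)%N.
  by move: sek; rewrite eE size_Mmonic ?monicXsubC // size_XsubC addn2.
have divX (r : {poly {poly K}}) : map_poly (horner_eval x) r = 0 ->
    exists r', r = ('X - x%:P) *: r'.
  move=> r0; exists (map_poly (fun c => c %/ ('X - x%:P)) r); apply/polyP => i.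
  rewrite coefZ coef_map_id0 ?div0p // mulrC divpK // dvdp_XsubCl /root.
  by have := congr1 (fun s : {poly K} => s`_i) r0; rewrite coef_map coef0 => /eqP.
have /eqP : map_poly (horner_eval x) q * map_poly (horner_eval x) f = 0.
  rewrite -rmorphM -eG /= map_polyZ /= /horner_eval eE hornerM hornerXsubC subrr.
  by rewrite mulr0 scale0r.
rewrite mulf_eq0 => /orP[] /eqP /divX[r rE] i.
  apply: (IH e' r) => //; apply: XI.
  by rewrite /= scalerA mulrC -eE eG rE scalerAl.
rewrite rE coefZ lead_coefZ dvdp_mul2l //; apply: (IH e' q) => //.
apply: XI.
by rewrite /= scalerA mulrC -eE eG rE scalerAr.
Qed.

Lemma of_polyK m : cancel (@of_poly K m) (@to_poly K m).
Proof.
move=> q; apply/eqP; rewrite -subr_eq0; apply/eqP/eval_coefs_eq0 => y t.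
by rewrite eval_coefsB hornerD hornerN to_polyE of_polyE subrr.
Qed.

(** When the divisor is monic up to a scalar, divisibility can be tested after
    specializing the coefficients, because the remainder of the Euclidean
    division vanishes under all specializations. *)
Lemma dvd_criterion m (c : K) (a b : {poly mpoly m K}) : c != 0 ->
  lead_coef b = mpolyC m c ->
  (forall y : 'rV[K]_m, eval_coefs y b %| eval_coefs y a) -> exists q, a = q * b.
Proof.
move=> c0 lb ab.
have ub : lead_coef b \is a GRing.unit by rewrite lb rmorph_unit // unitfE.
have aE := Pdiv.IdomainUnit.divp_eq ub a.
have b0 : b != 0 by rewrite -lead_coef_eq0 lb mpolyC_eq0.
exists (a %/ b); rewrite [LHS]aE; suff -> : a %% b = 0 by rewrite addr0.
apply: eval_coefs_inj => y; rewrite raddf0; apply/eqP; apply: contraT => r0.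
have : eval_coefs y b %| eval_coefs y (a %% b).
  move: (congr1 (eval_coefs y) aE); rewrite eval_coefsD eval_coefsM => /esym/(canRL (addKr _)) ->.
  by rewrite dvdp_add // dvdpNr dvdp_mull.
move=> /(dvdp_leq r0); rewrite leqNgt; case/negP.
have -> : size (eval_coefs y b) = size b.
  by rewrite size_map_poly_id0 // lb /= mevalC.
by rewrite (leq_ltn_trans (size_poly _ _)) // ltn_modp.
Qed.

Definition vanishes_poly m (C : set 'rV[K]_m.+1) (f : {poly mpoly m K}) :=
  forall t y, C (pt t y) -> (eval_coefs y f).[t] = 0.

Definition minimal_relation m (C : set 'rV[K]_m.+1) (f : {poly mpoly m K}) :=
  [/\ vanishes_poly C f, f != 0 & 
     forall g, vanishes_poly C g -> g != 0 -> (size f <= size g)%N].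

(** The remainder of the pseudo-division by [f] is a relation of smaller degree. *)
Lemma minimal_relation_divides m (C : set 'rV[K]_m.+1) f h : minimal_relation C f -> vanishes_poly C h ->
  exists k q, lead_coef f ^+ k *: h = q * f.
Proof.
move=> [vf f0 fmin] vh; have hE := Pdiv.WeakIdomain.divp_eq h f.
exists (scalp h f), (h %/ f); rewrite hE.
have [->|r0] := eqVneq (h %% f) 0; first by rewrite addr0.
have : vanishes_poly C (h %% f).
  move=> t y Cty; move: (congr1 (eval_coefs y) hE).
  rewrite eval_coefsD eval_coefsM eval_coefsZ => /esym/(canRL (addKr _)) ->.
  by rewrite hornerD hornerN hornerM hornerZ vh // vf // !mulr0 oppr0 addr0.
by move=> /fmin/(_ r0); rewrite leqNgt ltn_modp f0.
Qed.

(** Normality of the polynomial ring.  A relation [f] of least degree is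
    homogenized, so that its leading coefficient [a] becomes monic in the first
    of the remaining variables.  On each line in that direction Gauss's lemma
    applies, because a power of [a] times a monic relation is a multiple of
    [f]; so [a] divides all coefficients on each of these lines, hence in the
    polynomial ring.  The quotient is a monic relation of least degree, which
    divides every polynomial vanishing on [C]. *)
Lemma monic_equation_coord n (C : set 'rV[K]_n.+2) (f : {poly mpoly n.+1 K}) :
  prime_cone C -> ~ C (pt 1 0) -> (forall y, shadow C y) -> minimal_relation C f ->
  ev (pt 1 0) (lead_coef f) != 0 ->
  exists2 g : {poly mpoly n.+1 K}, g \is monic &
    forall t y, C (pt t y) <-> (eval_coefs y g).[t] = 0.
Proof.
move=> pC C1 shadowC fm lf0; have [[C0 CZ Cc] Cp _] := pC; have [vf f0 fmin] := fm.
have [G [mG _ vG]] := monic_relation (And3 C0 CZ Cc) C1.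
(* [F] is [f] homogenized in the degree [D] with respect to the first of the
   remaining variables, [p i] being the dehomogenized coefficient of [f];
   [D] is large enough for all terms to be divisible by that variable *)
pose p i := (to_poly f`_i).[1].
pose D := (\sum_(i < size f) msize (p i) + size f)%N.
have Dp i : (i < size f)%N -> (msize (p i) <= D - i)%N.
  move=> isf; rewrite leq_subRL; last by rewrite (leq_trans (ltnW isf)) // leq_addl.
  rewrite addnC leq_add //; last exact: ltnW.
  by rewrite (bigD1 (Ordinal isf)) //= leq_addr.
have evp i y : ev y (p i) = ev (pt 1 y) f`_i by rewrite -to_polyE /p -horner_map rmorph1.
pose F := \poly_(i < size f) of_poly (homogenize (D - i) (p i)).
have sf0 : ((size f).-1 < size f)%N by rewrite prednK // lt0n size_poly_eq0.
have [] := size_homogenize (Dp _ sf0) _.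
  by rewrite mcoeff0_ev evp.
set c := mcoeff _ _ => sH lH.
have c0 : c != 0 by rewrite /c mcoeff0_ev evp.
have toPF : to_poly (lead_coef F) = homogenize (D - (size f).-1) (p (size f).-1).
  rewrite lead_coef_poly // ?of_polyK //; first by rewrite lt0n size_poly_eq0.
  apply/negP => /eqP /(congr1 (@to_poly _ _)); rewrite of_polyK rmorph0 => h0.
  by move: sH; rewrite h0 size_poly0.
have lF : lead_coef (to_poly (lead_coef F)) = mpolyC n c by rewrite toPF.
have F0 : F != 0.
  by apply: contraNneq c0 => F0; move: lF; rewrite F0 lead_coef0 rmorph0 lead_coef0 => /eqP; rewrite eq_sym mpolyC_eq0.
have vF : vanishes_poly C F.
  move=> t v; rewrite -(ptK v); move: (v ord0 ord0) (\row_j _) => x y Ctxy.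
  have -> : (eval_coefs (pt x y) F).[t] = \sum_(i < size f) (eval_coefs y (homogenize (D - i) (p i))).[x] * t ^+ i.
    rewrite /F poly_def rmorph_sum horner_sum; apply: eq_bigr => i _.
    by rewrite /= /eval_coefs map_polyZ map_polyXn hornerZ hornerXn /= of_polyE.
  have [->|x0] := eqVneq x 0.
    by rewrite big1 // => i _; rewrite homogenize0E ?mul0r // Dp.
  transitivity (x ^+ D * (eval_coefs (x^-1 *: pt x y) f).[x^-1 * t]); last first.
    by rewrite vf ?mulr0 //; have := CZ x^-1 _ Ctxy; rewrite ptZ.
  have -> : eval_coefs (x^-1 *: pt x y) f = eval_coefs (x^-1 *: pt x y) (\sum_(i < size f) f`_i *: 'X^i).
    by rewrite -poly_def coefK.
  rewrite rmorph_sum horner_sum mulr_sumr; apply: eq_bigr => i _.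
  rewrite homogenizeE // ?Dp // evp /= /eval_coefs map_polyZ map_polyXn hornerZ hornerXn /=.
  rewrite ptZ mulVf // exprMn exprVn.
  have iD : (i <= D)%N by rewrite (leq_trans (ltnW (ltn_ord i))) // leq_addl.
  by rewrite expfB_cond ?(negbTE x0) // -!mulrA [_^-1 * (_ * _)]mulrCA.
have sF : (size F <= size f)%N by rewrite size_poly.
have Fm : minimal_relation C F.
  by split => // g vg g0; apply: leq_trans sF _; apply: fmin.
have [k [q GE]] := minimal_relation_divides Fm vG.
set a := lead_coef F in toPF lF GE.
have a0 : a != 0 by rewrite lead_coef_eq0.
(* Gauss's lemma on the lines in the direction of the first variable *)
have aF i : exists r, F`_i = r * a.
  have [y|r rE] := @dvd_criterion _ c (to_poly F`_i) (to_poly a) c0 lF.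
    pose psi : {rmorphism mpoly n.+1 K -> {poly K}} := eval_coefs y \o @to_poly K n.
    have ay : psi a != 0.
      apply: contraNneq c0 => h.
      have := coef_map (meval (y ord0)) (to_poly a) (size (to_poly a)).-1.
      by rewrite [map_poly _ _]h coef0 -lead_coefE lF /= mevalC => <-.
    have lphi : lead_coef (map_poly psi F) = psi a by rewrite lead_coef_map_eq.
    have eG : psi a ^+ k *: map_poly psi G = map_poly psi q * map_poly psi F.
      rewrite -(rmorphXn psi); apply: etrans (esym (map_polyZ psi (a ^+ k) G)) _.
      exact: etrans (congr1 (map_poly psi) GE) (rmorphM (map_poly psi) q F).
    have := lead_coef_dvdp (expf_neq0 k ay) (monic_map psi mG) eG i.
    by rewrite lphi coef_map.
  exists (of_poly r); rewrite -[LHS]to_polyK rE.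
  by apply: etrans (rmorphM (@of_poly K n) _ _) _; congr (_ * _); apply: to_polyK.
pose r i := sval (cid (aF i)).
have rE i : F`_i = r i * a by rewrite /r; case: (cid _).
pose g := \poly_(i < size F) r i.
have FE : F = a *: g.
  apply/polyP => i; rewrite coefZ [g`_i]coef_poly; case: ltnP => [_|sFi].
    by rewrite rE mulrC.
  by rewrite mulr0 nth_default.
have mg : g \is monic.
  rewrite monicE -(inj_eq (mulfI a0)) mulr1 -lead_coefZ -FE //.
have vg : vanishes_poly C g.
  have : vanishes C (subst_linear (drop_mx K n.+1) a * of_poly g).
    move=> v; rewrite -(ptK v) mevalM of_polyE subst_linearE pt_drop_mx => /vF.
    by rewrite FE /eval_coefs map_polyZ hornerZ.
  case/Cp => [va|vg]; last by move=> t y /vg; rewrite of_polyE.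
  case/eqP: a0; apply: ev_inj => y; rewrite meval0.
  have [t Cty] := shadowC y.
  by have := va _ Cty; rewrite subst_linearE pt_drop_mx.
have gm : minimal_relation C g.
  split; rewrite ?monic_neq0 // => h vh h0.
  by apply: leq_trans (size_poly _ _) (leq_trans sF _); apply: fmin.
exists g => // t y; split; first exact: vg.
move=> gty; apply: contrapT => /Cc[h vh /eqP []].
have [|j [s hE]] := minimal_relation_divides gm (h := to_poly h).
  by move=> u z /vh; rewrite to_polyE.
move: hE; rewrite (monicP mg) expr1n scale1r => /(congr1 (fun w => (eval_coefs y w).[t])).
by rewrite to_polyE rmorphM hornerM gty mulr0.
Qed.

Lemma subst_linear_inj m (B : 'M[K]_m) : B \in unitmx -> injective (subst_linear B).
Proof.
move=> uB p q h; apply: ev_inj => v.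
by have := congr1 (fun r => ev (v *m invmx B) r) h; rewrite !subst_linearE mulmxKV.
Qed.

Lemma eval_coefs_subst_linear m k (B : 'M[K]_(m, k)) (y : 'rV_m) f :
  eval_coefs y (map_poly (subst_linear B) f) = eval_coefs (y *m B) f.
Proof. by rewrite /eval_coefs -map_poly_comp; apply: eq_map_poly => c /=; rewrite subst_linearE. Qed.

(** A linear change of the remaining coordinates ensures that the leading
    coefficient of a minimal relation does not vanish at the first basis
    vector. *)
Lemma monic_equation n (C : set 'rV[K]_n.+2) :
  prime_cone C -> ~ C (pt 1 0) -> (forall y, shadow C y) ->
  exists2 g : {poly mpoly n.+1 K}, g \is monic &
    forall t y, C (pt t y) <-> (eval_coefs y g).[t] = 0.
Proof.
move=> pC C1 shadowC; have [clC _ _] := pC.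
have [G [mG _ vG]] := monic_relation clC C1.
have [f [vf f0 fmin]] : exists f, minimal_relation C f.
  pose P k := `[< exists g, [/\ vanishes_poly C g, g != 0 & size g = k] >].
  have [|k /asboolP[f [vf f0 sf]] kmin] := @ex_minnP P.
    by exists (size G); apply/asboolP; exists G; rewrite monic_neq0.
  exists f; split => // g vg g0; rewrite sf; apply: kmin.
  by apply/asboolP; exists g.
(* the factor [X_0] ensures that [z] is nonzero *)
have [z] : exists z : 'rV_n.+1, ev z (lead_coef f * mpolyX K (mnm1 ord0)) != 0.
  apply: ev_neq0; rewrite mulf_neq0 ?lead_coef_eq0 //.
  by apply/eqP => /(congr1 (mcoeff (mnm1 ord0))); rewrite mcoeffX eqxx mcoeff0 => /eqP; rewrite oner_eq0.
rewrite mevalM mevalXU mulf_eq0 negb_or => /andP[fz z0].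
have [|B uB Bz] := @complete_to_basis _ _ z.
  by apply: contraNneq z0 => ->; rewrite mxE.
pose B2 : 'M[K]_(1 + n.+1) := block_mx 1%:M 0 0 B.
have uB2 : B2 \in unitmx.
  by rewrite unitmxE det_ublock det1 mul1r -unitmxE.
have ptB t y : pt t y *m B2 = pt t (y *m B).
  apply: etrans (mul_row_block (t%:M : 'rV_1) y 1%:M 0 0 B) _.
  by rewrite !mulmx0 mulmx1 addr0 add0r.
have sB (A : 'M[K]_n.+1) h : A \in unitmx -> size (map_poly (subst_linear A) h) = size h.
  by move=> uA; rewrite size_map_inj_poly ?rmorph0 //; apply: subst_linear_inj.
have [] := @monic_equation_coord n [set v | C (v *m B2)] (map_poly (subst_linear B) f).
- exact: prime_cone_iso.
- by rewrite /= ptB mul0mx.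
- move=> y.
  have [t Ct] := shadowC (y *m B).
  by exists t; rewrite /= ptB.
- split.
  + by move=> t y /=; rewrite ptB => /vf; rewrite eval_coefs_subst_linear.
  + by rewrite -size_poly_eq0 sB // size_poly_eq0.
  + move=> g vg g0; rewrite sB //.
    have := fmin (map_poly (subst_linear (invmx B)) g).
    rewrite -size_poly_eq0 !sB ?unitmx_inv // size_poly_eq0 => -> //.
    by move=> t y Cty; rewrite eval_coefs_subst_linear; apply: vg; rewrite /= ptB mulmxKV.
- rewrite lead_coef_map_inj ?rmorph0 //; last exact: subst_linear_inj.
  by rewrite subst_linearE Bz.
move=> g mg Cg; exists (map_poly (subst_linear (invmx B)) g); first exact: monic_map.
move=> t y; rewrite eval_coefs_subst_linear; have := Cg t (y *m invmx B).
by rewrite /= ptB mulmxKV.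
Qed.

End MonicEquation.

(** * Cones over projective sets; irreducible components *)

Section ProjectivePoints.
Variables (K : fieldType) (d : nat).
Implicit Type v : 'rV[K]_d.+1.

Lemma line_subproof v : v != 0 -> \dim <[v]>%VS == 1%N.
Proof. by move=> v0; rewrite dim_vline v0. Qed.

Definition line_through v (v0 : v != 0) : 'P[K]_d := Grass (line_subproof v0).

Lemma proj_point_line (p : 'P[K]_d) v : v != 0 -> v \in (p : {vspace _}) ->
  (p : {vspace _}) = <[v]>%VS.
Proof.
move=> v0 vp; apply/eqP; rewrite eq_sym eqEdim -memvE vp.
by rewrite (eqP (grass_dim p)) dim_vline v0.
Qed.

Lemma proj_point_uniq (p q : 'P[K]_d) v : v != 0 ->
  v \in (p : {vspace _}) -> v \in (q : {vspace _}) -> p = q.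
Proof.
by move=> v0 vp vq; apply: grass_inj; rewrite (proj_point_line v0 vp) (proj_point_line v0 vq).
Qed.

Lemma proj_point_vector (p : 'P[K]_d) : exists2 v, v != 0 & v \in (p : {vspace _}).
Proof.
exists (vpick p); last exact: memv_pick.
by rewrite vpick0 -dimv_eq0 (eqP (grass_dim p)).
Qed.

End ProjectivePoints.

Section ProjectiveCones.
Variables (K : numClosedFieldType) (d : nat).
Implicit Types (X Z : set 'P[K]_d) (v w : 'rV[K]_d.+1).

(** The origin is included, so that the cone over the empty set is a cone. *)
Definition cone X : set 'rV[K]_d.+1 :=
  [set v | v = 0 \/ exists2 p : 'P[K]_d, X p & v \in (p : {vspace _})].

Lemma cone_point X (p : 'P[K]_d) v : v != 0 -> v \in (p : {vspace _}) ->
  cone X v <-> X p.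
Proof.
move=> v0 vp; split=> [[/eqP|[q Xq vq]]|Xp]; first by rewrite (negbTE v0).
  by rewrite (proj_point_uniq v0 vp vq).
by right; exists p.
Qed.

Lemma ev_homogeneous (f : mpoly d.+1 K) e a v : f \is ishomog1 e mdeg ->
  ev (a *: v) f = a ^+ e * ev v f.
Proof.
move=> /dhomogP hf; rewrite !mevalE mulr_sumr !big_seq; apply: eq_bigr => c cf.
under eq_bigr do rewrite mxE exprMn.
by rewrite big_split /= -expr_sum -mdegE hf // mulrCA.
Qed.

Lemma vanish_at_vector (f : mpoly d.+1 K) (p : 'P[K]_d) v : homogeneous f -> v != 0 ->
  v \in (p : {vspace _}) -> vanish_at f p <-> ev v f = 0.
Proof.
move=> [e hf] v0 vp; split; first by apply.
move=> fv w; rewrite (proj_point_line v0 vp) => /vlineP[a ->].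
by have := ev_homogeneous a v hf; rewrite fv mulr0.
Qed.

(** The factor [X_i] kills the origin, where a constant in the defining set of
    an empty [X] does not vanish. *)
Lemma closed_cone_cone X : zariski_closed X -> closed_cone (cone X).
Proof.
move=> [S Sh ->]; split; first by left.
  move=> a v [->|[p Sp vp]]; first by left; rewrite scaler0.
  by right; exists p => //; rewrite memvZ.
move=> v Cv; have v0 : v != 0 by apply/eqP => v0; apply: Cv; left.
have vl : v \in (line_through v0 : {vspace _}) by exact: memv_line.
have /existsNP[f /not_implyP[Sf fv]] : ~ zero_locus S (line_through v0).
  by move=> h; apply: Cv; right; exists (line_through v0).
have {}fv : ev v f != 0.
  by apply/eqP => h; apply: fv; apply/(vanish_at_vector (Sh _ Sf) v0 vl).
have [i vi] : exists i, v ord0 i != 0.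
  apply/existsP; apply: contraNT (v0) => /existsPn h; apply/eqP/rowP => i.
  by rewrite mxE; apply/eqP/negbNE/h.
exists (f * mpolyX K (mnm1 i)); last by rewrite mevalM mevalXU mulf_neq0.
move=> w [->|[p Sp wp]]; rewrite mevalM ?mevalXU; first by rewrite mxE mulr0.
by rewrite Sp ?mul0r.
Qed.

Definition homogeneous_components (p : mpoly d.+1 K) : set (mpoly d.+1 K) :=
  [set pihomog mdeg e p | e in [set e | (e < msize p)%N]].

Lemma homogeneous_componentsP p : homogeneous_components p `<=` @homogeneous K d.
Proof. by move=> _ [e _ <-]; exists e; exact: pihomogP. Qed.

Definition ray v (p : mpoly d.+1 K) : {poly K} :=
  \poly_(e < msize p) ev v (pihomog mdeg e p).

Lemma rayE v p s : (ray v p).[s] = ev (s *: v) p.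
Proof.
rewrite /ray horner_poly.
transitivity (ev (s *: v) (\sum_(e < msize p) pihomog mdeg e p)); last first.
  by rewrite -(pihomog_partitionE (leqnn (msize p))).
rewrite rmorph_sum /=; apply: eq_bigr => i _.
by rewrite mulrC; apply/esym/ev_homogeneous/pihomogP.
Qed.

Lemma ray_eq0 v p : ray v p = 0 -> forall f, homogeneous_components p f -> ev v f = 0.
Proof.
move=> h _ [e /= ep <-].
by have := congr1 (fun q : {poly K} => q`_e) h; rewrite coef_poly ep coef0.
Qed.

(** If [p * q] vanishes on the cone, then on each line through the origin one of
    the restrictions of [p] and [q] vanishes identically; the lines where a
    polynomial vanishes identically form the closed set cut out by its
    homogeneous components. *)
Lemma prime_cone_cone Z : irreducible_closed Z -> prime_cone (cone Z).
Proof.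
move=> [cZ [x Zx] irrZ]; have clZ := closed_cone_cone cZ; split=> //.
  move=> p q vpq.
  have zc r : zariski_closed (zero_locus (homogeneous_components r)).
    by exists (homogeneous_components r) => //; exact: homogeneous_componentsP.
  have zr r : Z `<=` zero_locus (homogeneous_components r) -> vanishes (cone Z) r.
    have vr y v : zero_locus (homogeneous_components r) y -> v \in (y : {vspace _}) ->
        forall s, ev (s *: v) r = 0.
      move=> hy vy s; rewrite -rayE (_ : ray v r = 0) ?horner0 //.
      apply/polyP => e; rewrite coef_poly coef0; case: ltnP => // er.
      by apply: hy => //; exists e.
    move=> Zr v [->|[y Zy vy]]; last by rewrite -(scale1r v); apply: vr vy _; apply: Zr.
    by rewrite -(scale0r 0); apply: vr (mem0v _) _; apply: Zr Zx.
  have cov : Z `<=` zero_locus (homogeneous_components p) `|` zero_locus (homogeneous_components q).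
    move=> y Zy; have [v v0 vy] := proj_point_vector y.
    have zv r : ray v r = 0 -> zero_locus (homogeneous_components r) y.
      move=> h f hf; apply/(vanish_at_vector (homogeneous_componentsP hf) v0 vy).
      exact: ray_eq0 h _ hf.
    have /eqP : ray v p * ray v q = 0.
      apply/eqP/negPn/negP => /nonzero_nonroot[t]; rewrite hornerM !rayE -mevalM.
      suff Ct : cone Z (t *: v) by rewrite vpq ?eqxx.
      by case: clZ => _ CZ _; apply: CZ; right; exists y.
    by rewrite mulf_eq0 => /orP[] /eqP /zv; [left|right].
  by have [/zr|/zr] := irrZ _ _ (zc p) (zc q) cov; [left|right].
have [v v0 vx] := proj_point_vector x; exists v => //.
by apply/(cone_point Z v0 vx).
Qed.

Lemma cone_proper Z1 Z2 : Z1 `<` Z2 -> cone Z1 `<` cone Z2.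
Proof.
move=> [Z12 /existsNP[x /not_implyP[Z2x Z1x]]]; split.
  by move=> v [->|[p /Z12 Zp vp]]; [left|right; exists p].
have [v v0 vx] := proj_point_vector x => h; apply: Z1x.
by apply/(cone_point Z1 v0 vx)/h/(cone_point Z2 v0 vx).
Qed.

Lemma cone_chain_cone Z n : irreducible_chain Z n -> cone_chain (cone Z) n.
Proof.
move=> [F [F1 F2]]; exists (cone \o F); split => i ni; last exact/cone_proper/F2.
have [irr FZ] := F1 i ni; split; first exact: prime_cone_cone.
by move=> v [->|[p /FZ Zp vp]]; [left|right; exists p].
Qed.

Definition irreducible_set (A : set 'P[K]_d) := forall Z1 Z2,
  zariski_closed Z1 -> zariski_closed Z2 -> A `<=` Z1 `|` Z2 -> A `<=` Z1 \/ A `<=` Z2.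

Definition zariski_closure (A : set 'P[K]_d) : set 'P[K]_d :=
  zero_locus [set f | homogeneous f /\ forall p, A p -> vanish_at f p].

Lemma zariski_closure_closed A : zariski_closed (zariski_closure A).
Proof. by eexists; last reflexivity; move=> f []. Qed.

Lemma sub_zariski_closure A : A `<=` zariski_closure A.
Proof. by move=> p Ap f [_]; apply. Qed.

Lemma zariski_closure_min A Z : zariski_closed Z -> A `<=` Z -> zariski_closure A `<=` Z.
Proof.
move=> [S Sh ->] AS p Ap f Sf; apply: Ap; split; first exact: Sh.
by move=> q /AS; apply.
Qed.

(** Zorn's lemma on the irreducible subsets of [X] through [x], which are stable
    under unions of chains; a maximal one is equal to its closure.  The point
    [x] is added to each set so that the union of the empty chain is covered. *)
Lemma irreducible_component_through X x : zariski_closed X -> X x ->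
  exists2 Z, irreducible_component X Z & Z x.
Proof.
move=> cX Xx.
pose P A := irreducible_set (A `|` [set x]) /\ A `<=` X.
have [F FP totF|A [[irrA AX] maxA]] := @Zorn_bigcup _ P.
  split; last by move=> p [A /FP[_ AX] /AX].
  move=> Z1 Z2 c1 c2 cov; apply: contrapT => /not_orP[].
  move=> /existsNP[a /not_implyP[Ua Z1a]] /existsNP[b /not_implyP[Ub Z2b]].
  have covx : (Z1 `|` Z2) x by apply: cov; right.
  suff [A [irrA Aa Ab Asub]] : exists A, [/\ irreducible_set (A `|` [set x]),
      (A `|` [set x]) a, (A `|` [set x]) b & A `<=` \bigcup_(A in F) A].
    have [p [/Asub Up|px]|h|h] := irrA _ _ c1 c2; last 2 first.
    - exact: Z1a (h _ Aa).
    - exact: Z2b (h _ Ab).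
    - by apply: cov; left.
    - by apply: cov; right.
  have sub A : F A -> A `<=` \bigcup_(A in F) A by move=> FA p Ap; exists A.
  have sub0 : irreducible_set (set0 `|` [set x]).
    move=> W1 W2 _ _ /(_ x) []; first by right.
      by move=> W1x; left => _ [//|->].
    by move=> W2x; right => _ [//|->].
  case: Ua => [[A FA Aa]|ax]; case: Ub => [[B FB Bb]|bx].
  - have [AB|BA] := totF _ _ FA FB.
      exists B; split; [exact: (FP _ FB).1|by left; apply: AB|by left|exact: sub].
    exists A; split; [exact: (FP _ FA).1|by left|by left; apply: BA|exact: sub].
  - exists A; split; [exact: (FP _ FA).1|by left|by right|exact: sub].
  - exists B; split; [exact: (FP _ FB).1|by right|by left|exact: sub].
  - by exists set0; split => //; right.
have maxE B : A `<=` B -> P B -> B = A.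
  move=> AB PB; apply: contrapT => BA; apply: (maxA B) => //; split => // BA'.
  by apply: BA; apply/seteqP.
have Ax : A x.
  have : A `|` [set x] = A.
    apply: maxE; first exact: subsetUl.
    split; first by rewrite -setUA setUid.
    by move=> p [/AX //|->].
  by move=> <-; right.
have Ux B : B x -> B `|` [set x] = B.
  by move=> Bx; apply/seteqP; split => [p [//|->]|p Bp]; [|left].
have Acl : zariski_closure A = A.
  apply: maxE; first exact: sub_zariski_closure.
  split; last exact: zariski_closure_min.
  rewrite Ux; last exact: sub_zariski_closure.
  move=> Z1 Z2 c1 c2 cov; rewrite Ux // in irrA.
  have [|h|h] := irrA _ _ c1 c2.
  - by move=> p Ap; apply: cov; apply: sub_zariski_closure.
  - by left; apply: zariski_closure_min.
  - by right; apply: zariski_closure_min.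
exists A => //; split=> //.
  split; [by rewrite -Acl; exact: zariski_closure_closed | by exists x | by rewrite -(Ux A)].
move=> Z' [cZ' _ irrZ'] ZX AZ; apply: maxE => //; split => //.
by rewrite Ux //; apply: AZ.
Qed.

End ProjectiveCones.

(** * Lifting affine lines *)

Section LineLift.
Variable K : numClosedFieldType.

Lemma projection_along m k j (N : 'M[K]_(k, m)) : row_free N -> m = (k + j)%N ->
  exists2 M : 'M[K]_(m, j), onto_mx M & forall v : 'rV_m, (v *m M == 0) = (v <= N)%MS.
Proof.
move=> fN mkj; have rk : \rank (cokermx N) = j.
  by rewrite mxrank_coker (eqP fN) mkj addKn.
suff [M sM kM] : exists2 M : 'M[K]_(m, \rank (cokermx N)), onto_mx M &
    forall v : 'rV_m, (v *m M == 0) = (v <= N)%MS.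
  by move: M sM kM; rewrite rk => M; exists M.
exists (col_base (cokermx N)).
  move=> w; have /submxP[v ->] : (w <= col_base (cokermx N))%MS.
    by rewrite submx_full // col_base_full.
  by exists v.
move=> v; rewrite submxE.
have -> : v *m cokermx N = v *m col_base (cokermx N) *m row_base (cokermx N).
  by rewrite -mulmxA mulmx_base.
rewrite -(mul0mx _ (row_base (cokermx N))).
by rewrite (inj_eq (row_free_inj (row_base_free _))).
Qed.

Definition restrict_line m (a b : 'rV[K]_m) : mpoly m K -> {poly K} :=
  mmap polyC (fun i => (a ord0 i)%:P + b ord0 i *: 'X).

HB.instance Definition _ m (a b : 'rV[K]_m) :=
  GRing.RMorphism.copy (restrict_line a b) (mmap _ _).

Lemma restrict_lineE m (a b : 'rV[K]_m) p u :
  (restrict_line a b p).[u] = ev (a + u *: b) p.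
Proof.
rewrite -[LHS]/(horner_eval u _) rmorph_mmap /= /mmap [RHS]mevalE.
apply: eq_bigr => c _; rewrite /= /horner_eval hornerC; congr (_ * _).
apply: eq_bigr => i _; congr (_ ^+ _); rewrite /= hornerD hornerC hornerZ hornerX.
by rewrite !mxE mulrC.
Qed.

Definition coord0 m (v : 'rV[K]_m.+1) := v ord0 ord0.
Definition coords m (v : 'rV[K]_m.+1) : 'rV[K]_m := \row_j v ord0 (lift ord0 j).

(** The trace of [X] on the affine space [a + <b, e, N>], taken modulo [N],
    contains a plane curve through the given point whose equation is monic in
    the direction of [e].  It comes from the component of [X] through that
    point: its projection from [N] has one monic equation. *)
Lemma line_lift d (X : set 'P[K]_d) k (N : 'M[K]_(k, d.+1)) (e a b : 'rV[K]_d.+1) t0 :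
  zariski_closed X -> pure_codim X k.+1 -> row_free N -> ~~ (e <= N)%MS ->
  (forall v, (v <= e + N)%MS -> cone X v -> v = 0) ->
  cone X (a + t0 *: e) -> a + t0 *: e != 0 ->
  exists Q : {poly {poly K}}, [/\ Q \is monic, Q.[t0%:P].[0] = 0 &
    forall u t, Q.[t%:P].[u] = 0 ->
      exists2 w, cone X w & (w - (a + u *: b + t *: e) <= N)%MS].
Proof.
move=> cX [n nd compX] fN eN avoids Xp p0.
have [x Xx xp] : exists2 x : 'P[K]_d, X x & a + t0 *: e \in (x : {vspace _}).
  by case: Xp => [/eqP|//]; rewrite (negbTE p0).
have [Z [irrZ ZX maxZ] Zx] := irreducible_component_through cX Xx.
have [/cone_chain_cone chZ _] := compX _ (And3 irrZ ZX maxZ).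
have pZ := prime_cone_cone irrZ.
have coneZX v : cone Z v -> cone X v.
  by move=> [->|[q /ZX Xq vq]]; [left|right; exists q].
have [M0 sM0 kM0] : exists2 M : 'M[K]_(d.+1, n.+2), onto_mx M &
    forall v : 'rV_d.+1, (v *m M == 0) = (v <= N)%MS.
  by apply: projection_along fN _; rewrite -nd [(n + _)%N]addnC addSn !addnS.
have [B uB Be] := complete_to_basis (etrans (congr1 negb (kM0 e)) eN).
(* [M] has kernel [N] and sends [e] to the first basis vector *)
pose M := M0 *m invmx B.
have kM (v : 'rV_d.+1) : (v *m M == 0) = (v <= N)%MS.
  by rewrite -kM0 mulmxA -{1}(mul0mx _ (invmx B)) (inj_eq (can_inj (mulmxKV uB))).
have sM : onto_mx M.
  by move=> w; have [v vM] := sM0 (w *m B); exists v; rewrite mulmxA vM mulmxK.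
have eM : e *m M = pt 1 0 by rewrite mulmxA -Be mulmxK.
have subN (v : 'rV_d.+1) : (v <= N)%MS -> (v <= e + N)%MS.
  by move=> h; apply: submx_trans h (addsmxSr _ _).
have kerZ v : cone Z v -> v *m M = 0 -> v = 0.
  by move=> /coneZX Xv /eqP; rewrite kM => /subN h; apply: avoids.
pose C := cone_img M (cone Z).
have [pC _] := prime_cone_img sM pZ kerZ.
have chC : cone_chain C n := cone_chain_img sM kerZ chZ.
have C1 : ~ C (pt 1 0).
  move=> [v Zv vM]; have v0 : v = 0.
    apply: avoids; last exact: coneZX.
    have veN : (v - e <= N)%MS by rewrite -kM mulmxBl vM eM subrr.
    rewrite -(subrK e v); apply: addmx_sub; [exact: subN | exact: addsmxSl].
  case/negP: eN; rewrite -kM eM -vM v0 mul0mx //.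
have [clC _ _] := pC; have [C0 CZ _] := clC.
have shC y : shadow C y.
  have /cone_chain_full h : cone_chain (shadow C) n.
    have -> : shadow C = cone_img (drop_mx K n.+1) C.
      apply/seteqP; split => [z [t Ct]|_ [v Cv <-]]; first by exists (pt t z); rewrite ?pt_drop_mx.
      by exists (coord0 v); rewrite -{2}(ptK v) pt_drop_mx ptK.
    apply: cone_chain_img chC; first by move=> w; exists (pt 0 w); rewrite pt_drop_mx.
    move=> v Cv; rewrite -(ptK v) pt_drop_mx => r0; rewrite r0.
    have [->|v0] := eqVneq (v ord0 ord0) 0; first exact: pt00.
    case: C1; have := CZ (v ord0 ord0)^-1 _ Cv.
    by rewrite -{2}(ptK v) r0 ptZ mulVf // scaler0.
  by apply: h; case: (prime_cone_shadow pC C1).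
have [g mg gP] := monic_equation pC C1 shC.
pose A := a *m M; pose D := b *m M.
pose phi := restrict_line (coords A) (coords D).
pose Q := (map_poly phi g) \Po ('X + ((coord0 A)%:P + coord0 D *: 'X)%:P).
have QE u t : Q.[t%:P].[u] = (eval_coefs (coords (A + u *: D)) g).[coord0 (A + u *: D) + t].
  rewrite horner_comp -[LHS]/(horner_eval u _) -horner_map /= -map_poly_comp.
  rewrite /horner_eval !hornerE /=.
  have -> : eval_coefs (coords (A + u *: D)) g = map_poly (horner_eval u \o phi) g.
    apply: eq_map_poly => c /=; rewrite /horner_eval restrict_lineE.
    by congr (ev _ _); apply/rowP => i; rewrite !mxE.
  by congr (_.[_]); rewrite [RHS]addrC /coord0 !mxE -addrA [_ * u]mulrC.
have QC u t : Q.[t%:P].[u] = 0 <-> C ((a + u *: b + t *: e) *m M).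
  rewrite QE -gP !mulmxDl -!scalemxAl eM -/A -/D.
  have -> : A + u *: D + t *: pt 1 0 = pt (coord0 (A + u *: D) + t) (coords (A + u *: D)).
    by rewrite -{1}(ptK (A + u *: D)) ptZ ptD scaler0 addr0 mulr1.
  by [].
exists Q; split.
- rewrite monicE lead_coef_comp ?size_XaddC // lead_coefXaddC expr1n mulr1.
  by rewrite -monicE monic_map.
- apply/QC; rewrite scale0r addr0; exists (a + t0 *: e) => //.
  by apply/(cone_point Z p0 xp).
move=> u t /QC[w Zw wM]; exists w; first exact: coneZX.
by rewrite -kM mulmxBl wM subrr.
Qed.

End LineLift.

(** * Moving roots of monic polynomials *)

Section RootMotion.
Local Open Scope complex_scope.

Lemma monic_root_bound (K : numFieldType) (q : {poly K}) t : q \is monic -> root q t ->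
  `|t| <= 1 + \sum_(i < size q) `|q`_i|.
Proof.
move=> mq /rootP qt; have S0 : 0 <= \sum_(i < size q) `|q`_i| by apply: sumr_ge0.
case: (real_leP (normr_real t) (real1 K)) => [t1|t1].
  by rewrite (le_trans t1) // lerDl.
rewrite (@le_trans _ _ (\sum_(i < size q) `|q`_i|)) // ?lerDr //.
move: qt (monicP mq) S0; rewrite horner_coef /lead_coef.
case sq: (size q) => [|[|k]]; rewrite ?big_ord0.
- by move=> _; rewrite nth_default ?sq // => /eqP; rewrite eq_sym oner_eq0.
- by rewrite big_ord1 /= => + q1; rewrite q1 expr0 mulr1 => /eqP; rewrite oner_eq0.
rewrite big_ord_recr /= => + qk; rewrite qk mul1r => /eqP.
rewrite addrC addr_eq0 => /eqP tE S0.
have tk : 0 < `|t| ^+ k by rewrite exprn_gt0 // (lt_trans ltr01).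
rewrite -(ler_pM2r tk) -exprS -normrX tE normrN.
apply: le_trans (ler_norm_sum _ _ _) _; rewrite [in leRHS]big_ord_recr /= mulrDl mulr_suml.
rewrite -[leLHS]addr0 lerD //.
apply: ler_sum => i _; rewrite normrM normrX ler_wpM2l // ler_weXn2l ?(ltW t1) //.
by rewrite -ltnS ltn_ord.
Qed.

Lemma poly_lipschitz (K : numDomainType) (c : {poly K}) : exists2 C, 0 <= C &
  forall u u', `|u| <= 1 -> `|u'| <= 1 -> `|c.[u] - c.[u']| <= C * `|u - u'|.
Proof.
elim/poly_ind: c => [|c a [C C0 IH]].
  by exists 0 => // u u' _ _; rewrite !horner0 subrr normr0 mul0r.
have [M cM] := poly_disk_bound c 1.
have M0 : 0 <= M by apply: le_trans (cM 0 _); rewrite ?normr0.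
exists (C + M); first exact: addr_ge0.
move=> u u' u1 u'1; rewrite !hornerMXaddC opprD addrACA subrr addr0.
have -> : c.[u] * u - c.[u'] * u' = (c.[u] - c.[u']) * u + c.[u'] * (u - u').
  by rewrite mulrBl mulrBr addrA subrK.
apply: le_trans (ler_normD _ _) _; rewrite [leRHS]mulrDl lerD // normrM.
  rewrite -[leRHS]mulr1 ler_pM // ?IH //.
by rewrite ler_wpM2r // cM.
Qed.

Lemma bipoly_lipschitz (K : numDomainType) (Q : {poly {poly K}}) B : 0 <= B ->
  exists2 C, 0 <= C & forall u u' t, `|u| <= 1 -> `|u'| <= 1 -> `|t| <= B ->
    `|Q.[t%:P].[u] - Q.[t%:P].[u']| <= C * `|u - u'|.
Proof.
move=> B0; elim/poly_ind: Q => [|Q c [C C0 IH]].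
  by exists 0 => // u u' t _ _ _; rewrite !horner0 subrr normr0 mul0r.
have [C' C'0 cC'] := poly_lipschitz c.
exists (C * B + C'); first by rewrite addr_ge0 // mulr_ge0.
move=> u u' t u1 u'1 tB; rewrite !hornerMXaddC !hornerD !hornerM !hornerC opprD addrACA.
rewrite -mulrBl (le_trans (ler_normD _ _)) // [leRHS]mulrDl lerD ?cC' // normrM.
by rewrite mulrAC ler_pM // IH.
Qed.

(** The value at [t] is the product of the distances from [t] to the roots. *)
Lemma near_root (K : numClosedFieldType) (q : {poly K}) t eps : q \is monic ->
  0 <= eps -> `|q.[t]| < eps ^+ (size q).-1 -> exists2 r, root q r & `|t - r| < eps.
Proof.
move=> mq e0; have [s qE] := closed_field_poly_normal q.
rewrite (monicP mq) scale1r in qE.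
move=> lt_q; apply: contrapT => h.
suff : eps ^+ (size q).-1 <= `|q.[t]|.
  move: lt_q; rewrite real_ltNge ?normr_real ?realX ?ger0_real // => /negP lt_q.
  exact: lt_q.
have {h} : forall r, r \in s -> eps <= `|t - r|.
  move=> r rs; rewrite real_leNgt ?normr_real ?ger0_real //; apply/negP => tr.
  by apply: h; exists r => //; rewrite qE root_prod_XsubC.
rewrite qE size_prod_XsubC horner_prod /= {qE}; elim: s => [|r s IH] h.
  by rewrite big_nil normr1 expr0.
rewrite big_cons hornerXsubC normrM exprS ler_pM ?exprn_ge0 ?h ?mem_head //.
by apply: IH => r' r's; apply: h; rewrite inE r's orbT.
Qed.

Variable R : realType.
Local Notation C := R[i].
Local Notation Re := complex.Re.
Local Notation Im := complex.Im.

Lemma normc_ge_Im (z : C) : `|Im z|%:C <= `|z|.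
Proof.
have := normc_ge_Re (z * 'i%C); rewrite ReiNIm normrN normrM.
suff -> : `|'i%C : C| = 1 by rewrite mulr1.
by rewrite normc_def /= expr0n /= add0r expr1n sqrtr1.
Qed.

(** A root in the open upper half-plane stays there as long as it does not cross
    the real axis.  Take the supremum of the parameters for which such a root
    exists: by continuity of the roots, which stay in a fixed disk, it is
    attained, and it can be exceeded if it is smaller than 1. *)
Lemma root_motion (Q : {poly {poly C}}) : Q \is monic ->
  (exists2 t, 0 < Im t & Q.[t%:P].[0] = 0) ->
  (forall (u t : R), 0 < u <= 1 -> Q.[t%:C%:P].[u%:C] <> 0) ->
  exists2 t, 0 < Im t & Q.[t%:P].[1] = 0.
Proof.
move=> mQ [t0 t0i Qt0] Qreal.
pose q (u : R) : {poly C} := map_poly (horner_eval u%:C) Q.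
have qE u t : (q u).[t] = Q.[t%:P].[u%:C].
  by rewrite -[RHS]/(horner_eval u%:C _) -horner_map /= /horner_eval hornerC.
have mq u : q u \is monic by exact: monic_map.
have szq u : size (q u) = size Q.
  by rewrite size_map_poly_id0 // (monicP mQ) /horner_eval hornerC oner_eq0.
pose S := [set u : R | 0 <= u <= 1 /\ exists2 t, 0 < Im t & root (q u) t].
have S0 : S 0 by split; [rewrite lexx ler01|exists t0 => //; apply/rootP; rewrite qE].
have Sub : ubound S 1 by move=> u [/andP[]].
have hS : has_sup S by split; [exists 0 | exists 1].
have disk (u : R) : 0 <= u <= 1 -> `|u%:C| <= 1.
  by move=> /andP[u0 u1]; rewrite ger0_norm ?ler0c // -[1]/(1%:C) lecR.
have [B B0 rootB] : exists2 B : C, 0 <= B & forall u t, 0 <= u <= 1 -> root (q u) t -> `|t| <= B.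
  pose M i := sval (poly_disk_bound Q`_i (1 : C)).
  have MP i u : 0 <= u <= 1 -> `|(q u)`_i| <= M i.
    by move=> u01; rewrite coef_map /= /M /horner_eval; case: poly_disk_bound => M' /= -> //; exact: disk.
  exists (1 + \sum_(i < size Q) M i).
    rewrite addr_ge0 // sumr_ge0 // => i _; apply: le_trans (MP i 0 _) => //.
    by rewrite lexx ler01.
  move=> u t u01 rt; apply: le_trans (monic_root_bound (mq u) rt) _.
  by rewrite szq lerD2l; apply: ler_sum => i _; apply: MP.
have [L L0 lipL] := bipoly_lipschitz Q B0.
have Lr : L = (Re L)%:C by rewrite RRe_real // ger0_real.
have RL0 : 0 <= Re L by rewrite -ler0c -Lr.
pose k := (size Q).-1.
(* continuity of the roots, uniform in the parameter *)
have close (eps : R) : 0 < eps -> exists2 delta : R, 0 < delta &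
    forall u u' t, 0 <= u <= 1 -> 0 <= u' <= 1 -> `|u - u'| < delta -> root (q u) t ->
      exists2 r, root (q u') r & `|Im t - Im r| < eps.
  move=> e0; exists (eps ^+ k / (Re L + 1)); first by rewrite divr_gt0 ?exprn_gt0 // ltr_wpDl.
  move=> u u' t u01 u'01 uu' rt.
  have uE : `|u%:C - u'%:C| = `|u - u'|%:C :> C.
    by rewrite -rmorphB normc_def /= expr0n addr0 sqrtr_sqr.
  have lt_q : `|(q u').[t]| < eps%:C ^+ (size (q u')).-1.
    rewrite szq -/k -rmorphXn /=; apply: (@le_lt_trans _ _ (L * `|u%:C - u'%:C|)).
      have := lipL u'%:C u%:C t (disk _ u'01) (disk _ u01) (rootB _ _ u01 rt).
      by rewrite -!qE (rootP rt) subr0 distrC.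
    rewrite uE Lr -rmorphM ltcR; move: uu'; rewrite ltr_pdivlMr ?ltr_wpDl //.
    by apply: le_lt_trans; rewrite mulrC ler_wpM2l // lerDl.
  have eC : 0 <= eps%:C :> C by rewrite ler0c ltW.
  have [r rr tr] := near_root (mq u') eC lt_q.
  exists r => //; rewrite -ltcR; apply: le_lt_trans tr.
  by have := normc_ge_Im (t - r); rewrite raddfB.
(* otherwise the roots at the supremum are below the real axis by a margin [e],
   and so are those at nearby parameters *)
have S1 : S (sup S).
  apply: contrapT => nS.
  have s01 : 0 <= sup S <= 1 by rewrite (ub_le_sup _ S0) ?ge_sup //; [exists 0|exists 1].
  have s0 : 0 < sup S.
    by rewrite lt_neqAle; case/andP: s01 => -> _; rewrite andbT; apply/eqP => s0; rewrite -s0 in nS.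
  have Imneg r : root (q (sup S)) r -> Im r < 0.
    move=> rr; rewrite real_ltNge ?num_real //; apply/negP; rewrite le_eqVlt => /predU1P[r0|r0].
      have : Q.[(Re r)%:C%:P].[(sup S)%:C] = 0.
        by rewrite -qE; move: (rootP rr); rewrite {1}(complexE r) -r0 mulr0 addr0.
      by apply: Qreal; rewrite s0; case/andP: s01.
    by apply: nS; split => //; exists r.
  have [e e0 Ime] : exists2 e : R, 0 < e & forall r, root (q (sup S)) r -> Im r <= - e.
    have [rs qrs] := closed_field_poly_normal (q (sup S)).
    have rootrs r : root (q (sup S)) r = (r \in rs).
      by rewrite qrs (monicP (mq _)) scale1r root_prod_XsubC.
    have h0 r : r \in rs -> Im r < 0 by rewrite -rootrs; exact: Imneg.
    suff [e e0 he] : exists2 e : R, 0 < e & forall r, r \in rs -> Im r <= - e.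
      by exists e => // r; rewrite rootrs; exact: he.
    elim: rs h0 {qrs rootrs} => [|r rs IH] h; first by exists 1.
    have [|e e0 he] := IH; first by move=> r' r'rs; apply: h; rewrite inE r'rs orbT.
    exists (Num.min e (- Im r)); first by rewrite lt_min e0 oppr_gt0 h // mem_head.
    move=> r'; rewrite inE => /predU1P[->|/he]; first by rewrite lerNr ge_min lexx orbT.
    by move=> /le_trans; apply; rewrite lerN2 ge_min lexx.
  have [delta d0 hd] := close e e0.
  have [u [u01 [t t0' rt]] ud] := sup_adherent d0 hS.
  have us : u <= sup S by apply: ub_le_sup; [exists 1|split => //; exists t].
  have [|r rr] := hd u (sup S) t u01 s01 _ rt.
    by rewrite ler0_norm ?subr_le0 // opprB ltrBlDl -ltrBlDr.
  have := Ime r rr => Ir; rewrite ltr_norml => /andP[_]; rewrite ltrBlDl.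
  move=> h; have := lt_trans t0' h; apply/negP; rewrite -leNgt.
  by rewrite -lerBrDr sub0r.
have [s01 [t ti rt]] := S1.
have [s1|s1] := eqVneq (sup S) 1.
  by exists t => //; move: (rootP rt); rewrite qE s1.
have s1' : sup S < 1 by rewrite lt_neqAle s1; case/andP: s01.
have [delta d0 hd] := close _ ti.
pose u := Num.min 1 (sup S + delta / 2).
have su : sup S < u by rewrite lt_min s1' ltrDl divr_gt0.
have u01 : 0 <= u <= 1.
  by rewrite ge_min lexx /= andbT; case/andP: s01 => s0 _; rewrite (le_trans s0) // ltW.
have [|r rr] := hd (sup S) u t s01 u01 _ rt.
  rewrite ltr0_norm ?subr_lt0 // opprB ltrBlDl.
  rewrite (@le_lt_trans _ _ (sup S + delta / 2)) ?ge_min ?lexx ?orbT // ltrD2l.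
  by rewrite ltr_pdivrMr // ltr_pMr // ltr1n.
rewrite ltr_norml => /andP[_]; rewrite ltrBlDl ltrDr => Ir0.
have : S u by split => //; exists r.
by move=> /(ub_le_sup (ex_intro _ 1 Sub : has_ubound S)); rewrite leNgt su.
Qed.

End RootMotion.

(** * Hyperbolicity is preserved when one basis vector moves *)

Section ComplexVectors.
Variable R : realType.
Local Notation C := R[i].
Local Notation toC := (map_mx (real_complex R)).

Definition re_mx m n (z : 'M[C]_(m, n)) : 'M[R]_(m, n) := map_mx (@complex.Re R) z.
Definition im_mx m n (z : 'M[C]_(m, n)) : 'M[R]_(m, n) := map_mx (@complex.Im R) z.

Lemma re_mxD m n (y z : 'M[C]_(m, n)) : re_mx (y + z) = re_mx y + re_mx z.
Proof. by apply/matrixP => i j; rewrite !mxE raddfD. Qed.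

Lemma im_mxD m n (y z : 'M[C]_(m, n)) : im_mx (y + z) = im_mx y + im_mx z.
Proof. by apply/matrixP => i j; rewrite !mxE raddfD. Qed.

Lemma re_mxZ m n c (z : 'M[C]_(m, n)) :
  re_mx (c *: z) = complex.Re c *: re_mx z - complex.Im c *: im_mx z.
Proof. by apply/matrixP => i j; rewrite !mxE; case: c (z i j) => a b [x y]. Qed.

Lemma im_mxZ m n c (z : 'M[C]_(m, n)) :
  im_mx (c *: z) = complex.Re c *: im_mx z + complex.Im c *: re_mx z.
Proof. by apply/matrixP => i j; rewrite !mxE; case: c (z i j) => a b [x y]. Qed.

Lemma re_mx0 m n : re_mx (0 : 'M[C]_(m, n)) = 0.
Proof. by apply/matrixP => i j; rewrite !mxE. Qed.

Lemma im_mx0 m n : im_mx (0 : 'M[C]_(m, n)) = 0.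
Proof. by apply/matrixP => i j; rewrite !mxE. Qed.

Lemma re_mxC m n (A : 'M[R]_(m, n)) : re_mx (toC A) = A.
Proof. by apply/matrixP => i j; rewrite !mxE. Qed.

Lemma im_mxC m n (A : 'M[R]_(m, n)) : im_mx (toC A) = 0.
Proof. by apply/matrixP => i j; rewrite !mxE. Qed.

Lemma re_im_mxE m n (z : 'M[C]_(m, n)) : z = toC (re_mx z) + 'i%C *: toC (im_mx z).
Proof. by apply/matrixP => i j; rewrite !mxE -complexE. Qed.

Lemma re_im_mx_eq0 m n (z : 'M[C]_(m, n)) : re_mx z = 0 -> im_mx z = 0 -> z = 0.
Proof. by move=> r0 i0; rewrite [z]re_im_mxE r0 i0 !map_mx0 scaler0 addr0. Qed.

Lemma re_mx_mul m n k (z : 'M[C]_(m, n)) (A : 'M[R]_(n, k)) :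
  re_mx (z *m toC A) = re_mx z *m A.
Proof.
apply/matrixP => i j; rewrite !mxE raddf_sum; apply: eq_bigr => l _.
by rewrite !mxE; case: (z i l) => a b /=; rewrite mulr0 subr0.
Qed.

Lemma im_mx_mul m n k (z : 'M[C]_(m, n)) (A : 'M[R]_(n, k)) :
  im_mx (z *m toC A) = im_mx z *m A.
Proof.
apply/matrixP => i j; rewrite !mxE raddf_sum; apply: eq_bigr => l _.
by rewrite !mxE; case: (z i l) => a b /=; rewrite mulr0 add0r.
Qed.

Lemma sub_toC m n (z : 'rV[C]_n) (A : 'M[R]_(m, n)) :
  (z <= toC A)%MS -> (re_mx z <= A)%MS /\ (im_mx z <= A)%MS.
Proof. by move=> /submxP[c ->]; rewrite re_mx_mul im_mx_mul !submxMl. Qed.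

End ComplexVectors.

Section Garding.
Variables (R : realType) (d : nat) (X : set 'P[R[i]]_d).
Local Notation C := R[i].
Local Notation toC := (map_mx (real_complex R)).

(** Hyperbolicity of [X] with respect to the row space of [A], see [hyperbolicP]. *)
Definition hyperbolic_mx m (A : 'M[R]_(m, d.+1)) := forall z, cone X z ->
  (re_mx z <= A)%MS -> re_mx z = 0.

(** The conclusion concerns [c] rather than [c *m A]: as the origin belongs to the
    cone, this makes the rows of [A] independent. *)
Definition avoids m (A : 'M[R]_(m, d.+1)) := forall c : 'rV[C]_m,
  cone X (c *m toC A) -> c = 0.

Lemma avoids_row_free m (A : 'M[R]_(m, d.+1)) : avoids A -> row_free A.
Proof.
move=> aA; rewrite -(row_free_map (real_complex R)); apply: inj_row_free => c cA.
by apply: aA; rewrite cA; left.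
Qed.

Lemma avoidsP m (A : 'M[R]_(m, d.+1)) : avoids A <->
  row_free A /\ forall z, (z <= toC A)%MS -> cone X z -> z = 0.
Proof.
split=> [aA|[fA hA] c /hA h].
  by split; [exact: avoids_row_free | move=> _ /submxP[c ->] /aA ->; rewrite mul0mx].
have : c *m toC A = 0 by apply: h; exact: submxMl.
by move/eqP; rewrite mulmx_free_eq0 ?row_free_map // => /eqP.
Qed.

Hypothesis cX : zariski_closed X.

Lemma coneZ a z : cone X z -> cone X (a *: z).
Proof. by have [_ + _] := closed_cone_cone cX; apply. Qed.

(** Multiplication by [-i] exchanges the real and the imaginary part. *)
Lemma hyperbolic_mx_im m (A : 'M[R]_(m, d.+1)) z : hyperbolic_mx A -> cone X z ->
  (im_mx z <= A)%MS -> im_mx z = 0.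
Proof.
move=> hA Xz zA; have := hA _ (coneZ (- 'i%C) Xz).
by rewrite re_mxZ raddfN raddfN /= oppr0 scale0r sub0r scaleN1r opprK; apply.
Qed.

Lemma hyperbolic_mx_avoids m (A : 'M[R]_(m, d.+1)) : row_free A -> hyperbolic_mx A -> avoids A.
Proof.
move=> fA hA; apply/avoidsP; split => // z /sub_toC[rz iz] Xz.
by apply: re_im_mx_eq0; [exact: hA | exact: hyperbolic_mx_im hA Xz iz].
Qed.

(** A root in the upper half-plane is followed from a given bad point to one that
    cannot exist.  The row [e'] is replaced by [v], the real part of the bad
    point normalized to differ from [e'] by an element of [N]; this changes
    neither the span of [e'] and [N] nor those of [e + b e'] and [N]. *)
Lemma garding k (N : 'M[R]_(k, d.+1)) (e e' : 'rV[R]_d.+1) :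
  pure_codim X k.+1 -> hyperbolic_mx (col_mx e N) -> avoids (col_mx e' N) ->
  (forall b : R, 0 <= b -> avoids (col_mx (e + b *: e') N)) -> hyperbolic_mx (col_mx e' N).
Proof.
move=> codX he ae' seg z Xz; have [fe' Ze'] := (avoidsP _).1 ae'.
have notN (u : 'rV_d.+1) : row_free (col_mx u N) -> ~~ (u <= N)%MS.
  move=> fu; apply/negP => /submxP[x ux].
  have : row_mx (1%:M : 'M[R]_1) (- x) *m col_mx u N = 0.
    by rewrite mul_row_col mul1mx mulNmx ux subrr.
  move/eqP; rewrite mulmx_free_eq0 // => /eqP /(congr1 lsubmx).
  by rewrite row_mxKl linear0 => /matrixP/(_ ord0 ord0)/eqP; rewrite !mxE oner_eq0.
have fN : row_free N.
  apply: inj_row_free => x xN; have : row_mx (0 : 'M[R]_1) x *m col_mx e' N = 0.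
    by rewrite mul_row_col mul0mx xN addr0.
  move/eqP; rewrite mulmx_free_eq0 // => /eqP /(congr1 rsubmx).
  by rewrite row_mxKr linear0.
have eN : ~~ (e <= N)%MS.
  apply: notN; have := avoids_row_free (seg 0 (lexx _)).
  by rewrite scale0r addr0.
have subN u v : (u <= N)%MS -> (u <= col_mx v N)%MS.
  by move=> h; rewrite -addsmxE; apply: submx_trans h (addsmxSr _ _).
have subE (v : 'rV[R]_d.+1) : (v <= col_mx v N)%MS by rewrite -addsmxE addsmxSl.
have -> : (re_mx z <= col_mx e' N)%MS = (re_mx z <= e' + N)%MS by rewrite addsmxE.
case/sub_addsmxP => -[x x'] /= zE; set n := x' *m N in zE.
have nN : (n <= N)%MS by exact: submxMl.
move: zE; rewrite [x]mx11_scalar mul_scalar_mx; set c := x 0 0 => zE.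
have [c0|c0] := eqVneq c 0.
  apply: he => //; apply: subN; by rewrite zE c0 scale0r add0r.
have Im_i : complex.Im ('i%C : C) = 1 by [].
have Re_i : complex.Re ('i%C : C) = 0 by [].
exfalso; pose z1 := (c^-1)%:C%C *: z; pose v := re_mx z1; pose w := im_mx z1.
have vE : v = e' + c^-1 *: n.
  by rewrite /v re_mxZ /= scale0r subr0 zE scalerDr scalerA mulVf // scale1r.
have c'n : (c^-1 *: n <= N)%MS by rewrite scalemx_sub.
have vN : ~~ (v <= N)%MS.
  apply: contra (notN _ fe') => vN.
  have -> : e' = v - c^-1 *: n by rewrite vE addrK.
  by apply: addmx_sub; rewrite ?eqmx_opp.
pose a := toC (- w); pose b := toC w + 'i%C *: toC e.
have aE : a + 'i%C *: toC v = 'i%C *: z1.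
  rewrite [z1]re_im_mxE -/v -/w scalerDr scalerA.
  have -> : 'i%C * 'i%C = -1 :> C by rewrite -expr2 sqr_i.
  by rewrite /a raddfN scaleN1r addrC.
have Xa : cone X (a + 'i%C *: toC v) by rewrite aE; do 2 apply: coneZ.
have a0 : a + 'i%C *: toC v != 0.
  apply: contraNneq vN => h; have : im_mx (a + 'i%C *: toC v) = 0 by rewrite h im_mx0.
  rewrite im_mxD im_mxZ !im_mxC re_mxC Re_i Im_i scale0r scale1r !add0r => ->.
  exact: sub0mx.
have fNC : row_free (toC N) by rewrite row_free_map.
have vNC : ~~ (toC v <= toC N)%MS by rewrite map_submx.
have avoidC (y : 'rV[C]_d.+1) : (y <= toC v + toC N)%MS -> cone X y -> y = 0.
  move=> h; apply: Ze'; apply: submx_trans h _; rewrite addsmx_sub !map_submx.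
  apply/andP; split; last by rewrite -addsmxE addsmxSr.
  by rewrite vE; apply: addmx_sub; [exact: subE | exact: subN].
have [Q [mQ Q0 QX]] := line_lift b cX codX fNC vNC avoidC Xa a0.
have [||t ti Qt] := root_motion mQ.
- by exists 'i%C.
- move=> u t /andP[u0 u1] /QX[y Xy /sub_toC[_]].
  rewrite im_mxD -scaleN1r im_mxZ /= oppr0 scale0r addr0 scaleN1r.
  rewrite !(im_mxD, im_mxZ, re_mxD, re_mxZ, im_mxC, re_mxC) Re_i Im_i /=.
  rewrite !(scaler0, scale0r, scale1r, subr0, addr0, add0r) => yN.
  have /(hyperbolic_mx_im he Xy) : (im_mx y <= col_mx e N)%MS.
    rewrite -(subrK (u *: e) (im_mx y)); apply: addmx_sub; first exact: subN.
    by rewrite scalemx_sub.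
  move=> y0; case/negP: eN; rewrite y0 sub0r eqmx_opp in yN.
  by rewrite -(scalerK (lt0r_neq0 u0) e) scalemx_sub.
have [y Xy yN] := QX _ _ Qt.
have abE : a + 1 *: b = 'i%C *: toC e.
  by rewrite scale1r /a /b raddfN addKr.
rewrite abE in yN.
set p := complex.Re t; set q := complex.Im t in ti.
have tE : t = p%:C%C + 'i%C * q%:C%C by exact: complexE.
have [p0|p0] := eqVneq p 0.
  (* [-i y] lies in the complex span of [e + q v] and [N] *)
  pose y' := - 'i%C *: y.
  have y'N : (y' - toC (e + q *: v) <= toC N)%MS.
    have -> : y' - toC (e + q *: v) = - 'i%C *: (y - ('i%C *: toC e + t *: toC v)).
      have ii : - 'i%C * 'i%C = 1 :> C by rewrite mulNr -expr2 sqr_i opprK.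
      rewrite scalerBr scalerDr !scalerA tE p0 rmorph0 add0r mulrA ii mul1r scale1r.
      by rewrite map_mxD map_mxZ.
    exact: scalemx_sub.
  have fq := seg q (ltW ti).
  have y'0 : y' = 0.
    have [_ Zq] := (avoidsP _).1 fq; apply: Zq; last exact: coneZ.
    rewrite -(subrK (toC (e + q *: v)) y'); apply: addmx_sub.
      by apply: submx_trans y'N _; rewrite map_submx -addsmxE addsmxSr.
    rewrite map_submx vE scalerDr addrA; apply: addmx_sub; first exact: subE.
    by apply: subN; rewrite scalemx_sub.
  case/negP: (notN _ (avoids_row_free fq)).
  move: y'N; rewrite y'0 sub0r eqmx_opp map_submx => evN.
  have -> : e + q *: e' = e + q *: v - q *: (c^-1 *: n).
    by rewrite vE scalerDr addrA addrK.
  by apply: addmx_sub => //; rewrite eqmx_opp scalemx_sub.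
(* multiplying by [- i] times the conjugate of [t] makes [p *: e] the real part
   modulo [N] *)
pose y' := Complex (- q) (- p) *: y.
have rN : (re_mx y' - p *: e <= N)%MS.
  have [] := sub_toC yN; rewrite -scaleN1r.
  rewrite !(im_mxD, im_mxZ, re_mxD, re_mxZ, im_mxC, re_mxC) Re_i Im_i /= -/p -/q.
  rewrite !(scaler0, scale0r, scale1r, subr0, addr0, add0r, oppr0, scaleN1r, sub0r).
  move=> rN iN; have -> : - q *: re_mx y - - p *: im_mx y - p *: e =
      (- q) *: (re_mx y - p *: v) + p *: (im_mx y - (e + q *: v)).
    by apply/rowP => j; rewrite !mxE; ring.
  by rewrite addmx_sub // scalemx_sub.
have /(he _ (coneZ _ Xy)) : (re_mx y' <= col_mx e N)%MS.
  rewrite -(subrK (p *: e) (re_mx y')); apply: addmx_sub; first exact: subN.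
  by rewrite scalemx_sub.
move=> y0; case/negP: eN; move: rN; rewrite y0 sub0r eqmx_opp => rN.
by rewrite -(scalerK p0 e) scalemx_sub.
Qed.

End Garding.

(** * Neighbourhoods of frames *)

Section Boxes.
Variables (R : realType) (d : nat) (X : set 'P[R[i]]_d).
Local Notation C := R[i].
Local Notation toC := (map_mx (real_complex R)).

Lemma row_split (F : fieldType) m n (A : 'M[F]_(m.+1, n)) j :
  (A :=: col_mx (row j A) (row' j A))%MS.
Proof.
apply/eqmxP/andP; split.
  apply/row_subP => i; rewrite -addsmxE; case: (unliftP j i) => [i'|] ->; last exact: addsmxSl.
  have -> : row (lift j i') A = row i' (row' j A) by apply/rowP => l; rewrite !mxE.
  by apply: submx_trans (row_sub _ _) (addsmxSr _ _).
rewrite -addsmxE addsmx_sub row_sub; apply/row_subP => i.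
by have -> : row i (row' j A) = row (lift j i) A; [apply/rowP => l; rewrite !mxE | exact: row_sub].
Qed.

Lemma hyperbolic_mx_eqmx m m' (A : 'M[R]_(m, d.+1)) (B : 'M[R]_(m', d.+1)) :
  (A :=: B)%MS -> hyperbolic_mx X A -> hyperbolic_mx X B.
Proof. by move=> AB hA z Xz; rewrite -AB; exact: hA. Qed.

Lemma avoids_eqmx m (A B : 'M[R]_(m, d.+1)) : (A :=: B)%MS -> avoids X A -> avoids X B.
Proof.
move=> AB /avoidsP[fA hA]; apply/avoidsP; split; first by rewrite /row_free -AB.
move=> z zB; apply: hA; apply: submx_trans zB _; rewrite map_submx.
by rewrite AB.
Qed.

Definition box m n (M : 'M[R]_(m, n)) (delta : R) : set 'M[R]_(m, n) :=
  [set A | forall i j, `|M i j - A i j| < delta].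

Hypothesis cX : zariski_closed X.

(** The matrix [D s] has its first [s] rows from [B] and the others from [A].
    The segment between two consecutive ones stays in the box, and up to a
    positive factor its points replace the moving row by [e + b e'] with
    [b >= 0]. *)
Lemma hyperbolic_mx_box k (M A B : 'M[R]_(k.+1, d.+1)) delta : pure_codim X k.+1 ->
  (forall D, box M delta D -> avoids X D) -> box M delta A -> box M delta B ->
  hyperbolic_mx X A -> hyperbolic_mx X B.
Proof.
move=> codX av bA bB hA.
pose D s : 'M[R]_(k.+1, d.+1) := \matrix_(i, j) if (i < s)%N then B i j else A i j.
suff hD s : (s <= k.+1)%N -> hyperbolic_mx X (D s).
  have <- : D k.+1 = B by apply/matrixP => i j; rewrite mxE ltn_ord.
  exact: hD.
elim: s => [_|s IH sk]; first by have -> : D 0%N = A by apply/matrixP => i j; rewrite mxE.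
have {IH} hs := IH (ltnW sk); pose j := Ordinal sk.
have row'E : row' j (D s.+1) = row' j (D s).
  apply/matrixP => i l; rewrite !mxE ltnS leq_eqVlt.
  by have /negbTE -> : (lift j i : nat) != s by rewrite eq_sym (neq_lift j i).
apply: hyperbolic_mx_eqmx (eqmx_sym (row_split _ j)) _; rewrite row'E.
(* scaling the moving row into the box *)
have avj (u : 'rV[R]_d.+1) (t : R) : t != 0 -> (forall l, `|M j l - t * u ord0 l| < delta) ->
    avoids X (col_mx u (row' j (D s))).
  move=> t0 bu; pose E : 'M[R]_(k.+1, d.+1) := \matrix_(i, l) if i == j then t * u ord0 l else D s i l.
  have bE : box M delta E.
    move=> i l; rewrite mxE; case: eqP => [->//|_]; rewrite mxE.
    by case: ifP => _; [exact: bB | exact: bA].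
  apply: avoids_eqmx (av _ bE); apply: eqmx_trans (row_split E j) _.
  have -> : row' j E = row' j (D s).
    by apply/matrixP => i l; rewrite !mxE eq_sym (negbTE (neq_lift _ _)).
  have -> : row j E = t *: u by apply/rowP => l; rewrite !mxE eqxx.
  have h1 := eqmx_sym (addsmxE (t *: u) (row' j (D s))).
  have h2 := adds_eqmx (eqmx_scale u t0) (eqmx_refl (row' j (D s))).
  exact: eqmx_trans (eqmx_trans h1 h2) (addsmxE _ _).
apply: (garding cX codX (hyperbolic_mx_eqmx (row_split _ j) hs)).
  apply: (avj _ 1); first exact: oner_neq0.
  by move=> l; rewrite mul1r !mxE leqnn; exact: bB.
move=> b b0; have b1 : 0 < 1 + b by rewrite ltr_wpDr.
apply: (avj _ (1 + b)^-1); first by rewrite invr_neq0 // gt_eqF.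
move=> l; rewrite !mxE leqnn ltnn.
have -> : M j l - (1 + b)^-1 * (A j l + b * B j l) =
   (1 + b)^-1 * ((M j l - A j l) + b * (M j l - B j l)).
  by field; rewrite gt_eqF.
rewrite normrM normfV (gtr0_norm b1) mulrC ltr_pdivrMr // [ltRHS]mulrDr mulr1.
apply: le_lt_trans (ler_normD _ _) _; apply: ltr_leD; first exact: bA.
by rewrite normrM (ger0_norm b0) mulrC ler_wpM2r // ltW // bB.
Qed.

End Boxes.

Section Compactness.
Variable R : realType.
Local Notation C := R[i].
Local Notation toC := (map_mx (real_complex R)).

(** Continuity for the topology given by real and imaginary parts. *)
Definition ccontinuous (T : topologicalType) (g : T -> C) :=
  continuous (fun t => complex.Re (g t)) /\ continuous (fun t => complex.Im (g t)).

Lemma ccontinuousC (T : topologicalType) c : ccontinuous (fun _ : T => c).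
Proof. by split => t; exact: cvg_cst. Qed.

Lemma ccontinuousD (T : topologicalType) (g h : T -> C) : ccontinuous g -> ccontinuous h ->
  ccontinuous (fun t => g t + h t).
Proof.
move=> [g1 g2] [h1 h2]; split => t.
  have -> : (fun t => complex.Re (g t + h t)) = (fun t => complex.Re (g t) + complex.Re (h t)).
    by apply/funext => u; rewrite raddfD.
  by apply: cvgD; [exact: g1|exact: h1].
have -> : (fun t => complex.Im (g t + h t)) = (fun t => complex.Im (g t) + complex.Im (h t)).
  by apply/funext => u; rewrite raddfD.
by apply: cvgD; [exact: g2|exact: h2].
Qed.

Lemma ccontinuousM (T : topologicalType) (g h : T -> C) : ccontinuous g -> ccontinuous h ->
  ccontinuous (fun t => g t * h t).
Proof.
move=> [g1 g2] [h1 h2]; split => t.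
  have -> : (fun t => complex.Re (g t * h t)) =
    (fun t => complex.Re (g t) * complex.Re (h t) - complex.Im (g t) * complex.Im (h t)).
    by apply/funext => u; case: (g u) (h u) => a b [].
  by apply: cvgB; apply: cvgM; [exact: g1|exact: h1|exact: g2|exact: h2].
have -> : (fun t => complex.Im (g t * h t)) =
    (fun t => complex.Re (g t) * complex.Im (h t) + complex.Im (g t) * complex.Re (h t)).
  by apply/funext => u; case: (g u) (h u) => a b [].
by apply: cvgD; apply: cvgM; [exact: g1|exact: h2|exact: g2|exact: h1].
Qed.

Lemma ccontinuous_sum (T : topologicalType) (I : Type) (r : seq I) (g : I -> T -> C) :
  (forall i, ccontinuous (g i)) -> ccontinuous (fun t => \sum_(i <- r) g i t).
Proof.
move=> h; elim: r => [|i r IH].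
  by under eq_fun do rewrite big_nil; exact: ccontinuousC.
by under eq_fun do rewrite big_cons; exact: ccontinuousD.
Qed.

Lemma ccontinuous_prod (T : topologicalType) (I : Type) (r : seq I) (g : I -> T -> C) :
  (forall i, ccontinuous (g i)) -> ccontinuous (fun t => \prod_(i <- r) g i t).
Proof.
move=> h; elim: r => [|i r IH].
  by under eq_fun do rewrite big_nil; exact: ccontinuousC.
by under eq_fun do rewrite big_cons; exact: ccontinuousM.
Qed.

Lemma ccontinuousX (T : topologicalType) (g : T -> C) n : ccontinuous g -> ccontinuous (fun t => g t ^+ n).
Proof.
move=> h; elim: n => [|n IH]; first by under eq_fun do rewrite expr0; exact: ccontinuousC.
by under eq_fun do rewrite exprS; exact: ccontinuousM.
Qed.

Lemma ccontinuous_ev (T : topologicalType) n (z : T -> 'rV[C]_n) (f : mpoly n C) :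
  (forall i, ccontinuous (fun t => z t ord0 i)) -> ccontinuous (fun t => ev (z t) f).
Proof.
move=> h; under eq_fun do rewrite mevalE; apply: ccontinuous_sum => c.
apply: ccontinuousM; first exact: ccontinuousC.
by apply: ccontinuous_prod => i; apply: ccontinuousX.
Qed.

Lemma ccontinuous_near_neq0 (T : topologicalType) (g : T -> C) t : ccontinuous g -> g t != 0 ->
  \forall s \near t, g s != 0.
Proof.
move=> [g1 g2]; rewrite {1}(complexE (g t)); have [r0|r0] := eqVneq (complex.Re (g t)) 0.
  rewrite r0 add0r mulf_eq0 negb_or => /andP[_ i0].
  have {}i0 : complex.Im (g t) != 0 by apply: contraNneq i0 => ->.
  have nz : \forall s \near t, complex.Im (g s) != 0 by apply: cvgr_neq0 (g2 t) i0.
  apply: filterS nz => s /=; apply: contraNneq => ->.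
  by [].
move=> _; have nz : \forall s \near t, complex.Re (g s) != 0 by apply: cvgr_neq0 (g1 t) r0.
apply: filterS nz => s /=; apply: contraNneq => ->.
by [].
Qed.

(** Compactness of the unit sphere of the real pairs that encode the coefficient
    vectors of a complex linear combination of the rows. *)
Lemma avoids_near d (X : set 'P[C]_d) k (M : 'M[R]_(k.+1, d.+1)) : zariski_closed X ->
  avoids X M -> \forall A \near M, avoids X A.
Proof.
move=> cX aM; have [X0 XZ Xc] := closed_cone_cone cX.
pose c (x : 'rV[R]_(k.+1 + k.+1)) : 'rV[C]_k.+1 := toC (lsubmx x) + 'i%C *: toC (rsubmx x).
pose K := [set x : 'rV[R]_(k.+1 + k.+1) | `|x| = 1].
have cK : compact K.
  apply: bounded_closed_compact.
    exists 1; split; first exact: num_real.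
    by move=> y y1 x /= ->; rewrite ltW.
  have -> : K = Num.norm @^-1` [set 1] by [].
  by apply: closed_comp; [move=> x _; exact: norm_continuous | exact: closed_eq].
move: cK => /compact_near_coveringP.
move=> /(_ _ (nbhs M) (fun A x => ~ cone X (c x *m toC A))) cov.
have : \near M, K `<=` (fun x => ~ cone X (c x *m toC M)).
  apply: cov => x Kx.
  have /Xc[f vf fx] : ~ cone X (c x *m toC M).
    move=> /aM c0; have x0 : x = 0.
      rewrite -[x]hsubmxK.
      have re0 := congr1 (@re_mx R _ _) c0; have im0 := congr1 (@im_mx R _ _) c0.
      move: re0 im0; rewrite /c re_mxD im_mxD re_mxZ im_mxZ !re_mxC !im_mxC re_mx0 im_mx0 /=.
      rewrite !(scaler0, scale0r, scale1r, subr0, addr0, add0r) => -> ->.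
      exact: row_mx0.
    by move: Kx; rewrite /K /= x0 normr0 => /eqP; rewrite eq_sym oner_eq0.
  pose g (p : 'rV[R]_(k.+1 + k.+1) * 'M[R]_(k.+1, d.+1)) := ev (c p.1 *m toC p.2) f.
  have cg : ccontinuous g.
    apply: ccontinuous_ev => j; under eq_fun do rewrite mxE; apply: ccontinuous_sum => i.
    apply: ccontinuousM.
      split.
        have -> : (fun t : 'rV[R]_(k.+1 + k.+1) * 'M[R]_(k.+1, d.+1) =>
            complex.Re (c t.1 ord0 i)) = (fun v : 'rV[R]_(k.+1 + k.+1) => v ord0 (lshift k.+1 i)) \o fst.
          by apply/funext => -[y A]; rewrite !mxE /=; ring.
        by move=> t; apply: continuous_comp; [exact: cvg_fst | exact: coord_continuous].
      have -> : (fun t : 'rV[R]_(k.+1 + k.+1) * 'M[R]_(k.+1, d.+1) =>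
          complex.Im (c t.1 ord0 i)) = (fun v : 'rV[R]_(k.+1 + k.+1) => v ord0 (rshift k.+1 i)) \o fst.
        by apply/funext => -[y A]; rewrite !mxE /=; ring.
      by move=> t; apply: continuous_comp; [exact: cvg_fst | exact: coord_continuous].
    split.
      have -> : (fun t : 'rV[R]_(k.+1 + k.+1) * 'M[R]_(k.+1, d.+1) =>
          complex.Re (toC t.2 i j)) = (fun A : 'M[R]_(k.+1, d.+1) => A i j) \o snd.
        by apply/funext => -[y A]; rewrite mxE.
      by move=> t; apply: continuous_comp; [exact: cvg_snd | exact: coord_continuous].
    have -> : (fun t : 'rV[R]_(k.+1 + k.+1) * 'M[R]_(k.+1, d.+1) =>
        complex.Im (toC t.2 i j)) = (fun=> 0).
      by apply/funext => -[y A]; rewrite mxE.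
    by move=> t; exact: cvg_cst.
  apply: filterS (ccontinuous_near_neq0 (t := (x, M)) cg fx) => -[y A] /= gy Xy.
  by move: gy; rewrite /g /= vf ?eqxx.
apply: filterS => A hA u Xu; apply/eqP/negPn/negP => u0.
pose x := row_mx (re_mx u) (im_mx u).
have x0 : `|x| != 0.
  rewrite normr_eq0; apply: contra u0 => /eqP x0.
  apply/eqP/re_im_mx_eq0.
    by rewrite -(row_mxKl (re_mx u) (im_mx u)) -/x x0 linear0.
  by rewrite -(row_mxKr (re_mx u) (im_mx u)) -/x x0 linear0.
have /hA : K (`|x|^-1 *: x).
  by rewrite /K /= normrZ normfV normr_id mulVf.
apply; have -> : c (`|x|^-1 *: x) = (`|x|^-1)%:C%C *: u.
  rewrite /c !linearZ /= row_mxKl row_mxKr !map_mxZ scalerA mulrC -scalerA -scalerDr.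
  by rewrite -re_im_mxE.
by rewrite -scalemxAl; exact: XZ.
Qed.

End Compactness.

(** * From subspaces to frames; the theorem *)

Section Translation.
Variables (R : realType) (d : nat).
Local Notation C := R[i].
Local Notation toC := (map_mx (real_complex R)).

Lemma real_subvariety_closed (X : set 'P[C]_d) : real_subvariety X -> zariski_closed X.
Proof.
move=> [S Sh XE]; exists [set map_mpoly (real_complex R) f | f in S] => //.
move=> _ [f /Sh[e /dhomogP hf] <-]; exists e; apply/dhomogP => m.
rewrite mcoeff_msupp mcoeff_map_mpoly => h; apply: hf; rewrite mcoeff_msupp.
by apply: contraNneq h => ->; apply/eqP; exact: (rmorph0 (real_complex R)).
Qed.

Lemma mem_grass m (V : 'G[R](m, d)) v : (v \in (V : {vspace _})) = (v <= basis_mx V)%MS.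
Proof. by rewrite -memv_rowspan rowspan_basis_mx. Qed.

Lemma mem_complexify m (V : 'G[R](m, d)) z :
  (z \in (complexify V : {vspace _})) = (z <= toC (basis_mx V))%MS.
Proof. exact: memv_rowspan. Qed.

Lemma basis_grass_of m (A : frame R m d) : (basis_mx (grass_of A) :=: set_val A)%MS.
Proof.
have E (v : 'rV[R]_d.+1) : (v <= basis_mx (grass_of A))%MS = (v <= set_val A)%MS.
  by rewrite -mem_grass memv_rowspan.
apply/eqmxP/andP; split; apply/row_subP => i; first by rewrite -E row_sub.
by rewrite E row_sub.
Qed.

Lemma sub_point (p : 'P[C]_d) z m (W : 'G[C](m, d)) : z != 0 -> z \in (p : {vspace _}) ->
  points W p <-> z \in (W : {vspace _}).
Proof.
by move=> z0 zp; rewrite /points /= (proj_point_line z0 zp) -memvE.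
Qed.

Variable X : set 'P[C]_d.
Hypothesis cX : zariski_closed X.

Lemma avoids_grass m (V : 'G[R](m, d)) :
  avoids X (basis_mx V) <-> ~ (points (complexify V) `&` X !=set0).
Proof.
split=> [/avoidsP[_ aV] [p [Vp Xp]]|nV].
  have [z z0 zp] := proj_point_vector p; move/eqP: (z0); apply; apply: aV.
    by rewrite -mem_complexify; apply/(sub_point _ z0 zp).
  exact/(cone_point X z0 zp).
apply/avoidsP; split; first exact: basis_mx_free.
move=> z zV [//|[p Xp zp]]; apply/eqP/negPn/negP => z0; apply: nV; exists p; split => //.
by apply/(sub_point _ z0 zp); rewrite mem_complexify.
Qed.

(** Let [z] be a vector of the cone with real part [v] in [V] and imaginary part
    [w].  If [v] is nonzero, then [w] is not in [V] because the complex span of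
    [V] avoids [X]; but the point [z] of the subspace [U] spanned by [V] and [w]
    is real, so that [w] is a multiple of [v].  Conversely, [V] is a hyperplane
    in [U], so some nonzero real combination of the real and imaginary parts of
    a vector of [U] lies in [V].  It is the real part of a complex multiple of
    that vector, hence zero, which makes the vector proportional to a real
    one. *)
Lemma hyperbolicP m (V : 'G[R](m, d)) : 
  hyperbolic_wrt m.+1 X V <-> hyperbolic_mx X (basis_mx V).
Proof.
split=> [[V0 VU] z Xz zV|hV].
  set v := re_mx z in zV *; pose w := im_mx z.
  apply/eqP/negPn/negP => v0.
  have z0 : z != 0 by apply: contraNneq v0 => z0; rewrite /v z0 re_mx0.
  have [p Xp zp] : exists2 p : 'P[C]_d, X p & z \in (p : {vspace _}).
    by case: Xz => [/eqP|//]; rewrite (negbTE z0).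
  have avV : avoids X (basis_mx V).
    by apply/avoids_grass => -[q Vq]; move: Vq; rewrite V0.
  have [wV|wV] := boolP (w <= basis_mx V)%MS.
    have [_ aV] := (avoidsP _ _).1 avV; move/eqP: (z0); apply; apply: aV => //.
    rewrite [z]re_im_mxE; apply: addmx_sub; first by rewrite map_submx.
    by rewrite scalemx_sub // map_submx.
  have fW : row_free (col_mx w (basis_mx V)).
    apply: inj_row_free => x; rewrite -[x]hsubmxK mul_row_col.
    rewrite [lsubmx x]mx11_scalar mul_scalar_mx; set c := lsubmx x 0 0.
    move=> h; have cw : (c *: w <= basis_mx V)%MS.
      by move/eqP: h; rewrite addr_eq0 => /eqP ->; rewrite eqmx_opp submxMl.
    have c0 : c = 0.
      by apply/eqP; apply: contraNT wV => c0; rewrite -(scalerK c0 w) scalemx_sub.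
    move: h; rewrite c0 scale0r add0r => /eqP; rewrite mulmx_free_eq0 ?basis_mx_free // => /eqP ->.
    by rewrite raddf0 row_mx0.
  have VW : (basis_mx V <= col_mx w (basis_mx V))%MS by rewrite -addsmxE addsmxSr.
  have wW : (w <= col_mx w (basis_mx V))%MS by rewrite -addsmxE addsmxSl.
  pose U : 'G[R](m.+1, d) := Grass (rowspan_subproof (fW : row_free (col_mx w (basis_mx V) : 'M[R]_(m.+2, d.+1)))).
  have VU1 : (V <= U)%VS.
    apply/subvP => x; rewrite mem_grass memv_rowspan => xV.
    exact: submx_trans xV VW.
  have zU : z \in (complexify U : {vspace _}).
    have UE : (col_mx w (basis_mx V) <= basis_mx U)%MS.
      by apply/row_subP => i; rewrite -mem_grass memv_rowspan row_sub.
    rewrite mem_complexify [z]re_im_mxE; apply: addmx_sub.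
      by rewrite map_submx; apply: submx_trans UE; apply: submx_trans zV VW.
    by rewrite scalemx_sub // map_submx; apply: submx_trans UE.
  have [_ [q _ qp]] : real_points X p by apply: (VU U VU1); split => //; apply/(sub_point _ z0 zp).
  have [r r0 rq] := proj_point_vector q.
  have rCq : toC r \in (p : {vspace _}).
    by rewrite -qp mem_complexify map_submx -mem_grass.
  have rC0 : toC r != 0 by rewrite map_mx_eq0.
  have /vlineP[c zE] : z \in <[toC r]>%VS by rewrite -(proj_point_line rC0 rCq).
  have vE : v = complex.Re c *: r by rewrite /v zE re_mxZ re_mxC im_mxC scaler0 subr0.
  have wE : w = complex.Im c *: r by rewrite /w zE im_mxZ re_mxC im_mxC scaler0 add0r.
  have c0 : complex.Re c != 0 by apply: contraNneq v0 => c0; rewrite vE c0 scale0r.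
  case/negP: wV; rewrite wE scalemx_sub //.
  by rewrite -(scalerK c0 r) -vE scalemx_sub.
have aV : avoids X (basis_mx V) by apply: hyperbolic_mx_avoids => //; exact: basis_mx_free.
split.
  rewrite -subset0 => p Vp; have /avoids_grass := aV; apply; by exists p.
move=> U VU p [Xp Up]; split => //.
have [z z0 zp] := proj_point_vector p.
have Xz : cone X z by apply/(cone_point X z0 zp).
have /sub_toC[aU bU] : (z <= toC (basis_mx U))%MS.
  by rewrite -mem_complexify; apply/(sub_point _ z0 zp).
set a := re_mx z in aU; set b := im_mx z in bU.
(* some nonzero real combination of [a] and [b] lies in [V] *)
have [s [t [st stV]]] : exists s t : R, (s != 0) || (t != 0) /\ ((s *: a + t *: b)%R <= basis_mx V)%MS.
  have [u uU uV] : exists2 u, u \in (U : {vspace _}) & u \notin (V : {vspace _}).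
    apply/subvPn; apply/negP => /dimvS.
    by rewrite (eqP (grass_dim U)) (eqP (grass_dim V)) ltnn.
  have VuU : (V + <[u]> = U)%VS.
    apply/eqP; rewrite eqEdim subv_add VU -memvE uU /= (eqP (grass_dim U)).
    rewrite -(eqP (grass_dim V)) ltnNge; apply: contra uV => le.
    have /eqP -> : (V : {vspace _}) == (V + <[u]>)%VS by rewrite eqEdim addvSl.
    by rewrite memvE addvSr.
  have dec (x : 'rV[R]_d.+1) : (x <= basis_mx U)%MS -> exists2 c, true & (x - c *: u <= basis_mx V)%MS.
    rewrite -mem_grass -VuU => /memv_addP[y yV [y' /vlineP[c ->] ->]].
    by exists c => //; rewrite addrK -mem_grass.
  have [al _ aal] := dec _ aU; have [be _ bbe] := dec _ bU.
  have [al0|al0] := eqVneq al 0.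
    exists 1, 0; split; first by rewrite oner_neq0.
    by rewrite scale1r scale0r addr0; move: aal; rewrite al0 scale0r subr0.
  exists be, (- al); split; first by rewrite oppr_eq0 al0 orbT.
  have -> : be *: a + - al *: b = be *: (a - al *: u) - al *: (b - be *: u).
    by apply/rowP => j; rewrite !mxE; ring.
  by rewrite addmx_sub // ?eqmx_opp scalemx_sub.
(* the real part of [c *: z] is [s *: a + t *: b] *)
pose c : C := Complex s (- t).
have c0 : c != 0 by rewrite eq_complex /= oppr_eq0 negb_and.
have re0 : re_mx (c *: z) = 0.
  by apply: hV; [exact: coneZ | rewrite re_mxZ /= scaleNr opprK].
pose r := im_mx (c *: z).
have czE : c *: z = 'i%C *: toC r.
  by rewrite [LHS]re_im_mxE re0 map_mx0 add0r.
have rp : toC r \in (p : {vspace _}).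
  have -> : toC r = (- 'i%C * c) *: z.
    rewrite -scalerA czE scalerA mulNr -expr2 sqr_i opprK scale1r //.
  by rewrite memvZ.
have r0 : r != 0.
  apply: contraNneq z0 => r0; move: czE; rewrite r0 map_mx0 scaler0 => /eqP.
  by rewrite scaler_eq0 (negbTE c0).
exists (line_through r0) => //; apply: (proj_point_uniq (v := toC r)) => //.
  by rewrite map_mx_eq0.
by rewrite mem_complexify map_submx -mem_grass memv_line.
Qed.

End Translation.

Section Main.
Variables (R : realType) (d : nat).
Local Notation C := R[i].
Variable X : set 'P[C]_d.
Hypothesis cX : zariski_closed X.

(** The topology of the Grassmannian is a quotient of that of the frames, and [P]
    depends on the row space only. *)
Lemma open_grass m (P : 'M[R]_(m.+1, d.+1) -> Prop) :
  (forall A B : 'M[R]_(m.+1, d.+1), (A :=: B)%MS -> P A -> P B) ->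
  (forall A, row_free A -> P A -> \forall B \near A, P B) ->
  open [set V : 'G[R](m, d) | P (basis_mx V)].
Proof.
move=> Peq Pnear.
have piE : \pi_('G[R](m, d))%qT = @grass_of R m d by apply/funext => A; rewrite unlock.
rewrite /open /= /quotient_open piE.
rewrite openE => A /= PA.
have {}PA : P (set_val A) by apply: Peq PA; exact: basis_grass_of.
have fA : row_free (set_val A) by have := set_valP A.
have := Pnear _ fA PA => nA.
have : nbhs A (set_val @^-1` [set B | P B]).
  by apply: (@initial_continuous _ _ (set_val : frame R m d -> _) A); exact: nA.
by apply: filterS => B /= PB; apply: Peq PB; apply: eqmx_sym; exact: basis_grass_of.
Qed.

Lemma hyperbolic_mx_near m (M : 'M[R]_(m.+1, d.+1)) : pure_codim X m.+1 -> avoids X M ->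
  \forall A \near M, avoids X A /\ (hyperbolic_mx X A <-> hyperbolic_mx X M).
Proof.
move=> codX /(avoids_near cX) /nbhs_ballP[delta /= d0 ballM].
apply/nbhs_ballP; exists delta => // A bA; split; first exact: ballM.
have bE D : box M delta D -> avoids X D by move=> h; apply: ballM.
have bM : box M delta M by move=> i j; rewrite subrr normr0.
have bA' : box M delta A by move=> i j; exact: (bA.2 i j).
by split; exact: (hyperbolic_mx_box cX codX bE).
Qed.

End Main.

Theorem theorem3p10 (R : realType) (d l : nat) (hl : (1 <= l)%N)
  (X : set 'P[R[i]]_d) (realX : real_subvariety X) (codimX : pure_codim X l)
  (V : 'G[R](l.-1, d)) (hypV : hyperbolic_wrt l X V)
  (Y : set 'G[R[i]](l.-1, d)) (defY : Y = associated_hypersurface l.-1 X) :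
  forall V' : 'G[R](l.-1, d),
    connected_component (~` real_locus Y) V V' -> hyperbolic_wrt l X V'.
Proof.
case: l hl codimX V hypV Y defY => // m _ codX V hV Y -> V'.
rewrite /= in V hV V' *; have cX := real_subvariety_closed realX.
move=> [D [DV DY cD] DV']; apply/(hyperbolicP cX).
have DA (W : 'G[R](m, d)) : D W -> avoids X (basis_mx W).
  move=> /DY h; apply: (avoids_grass X W).2 => -[p [Wp Xp]].
  by apply: h; exists p.
pose H : set 'G[R](m, d) := [set W | hyperbolic_mx X (basis_mx W)].
(* [H] is closed relatively to [D], because [H'] is open *)
pose H' : set 'G[R](m, d) := [set W | avoids X (basis_mx W) /\ ~ hyperbolic_mx X (basis_mx W)].
have oH : open H.
  apply: open_grass; first by move=> A B; exact: hyperbolic_mx_eqmx.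
  move=> A fA hA; have aA := hyperbolic_mx_avoids cX fA hA.
  by apply: filterS (hyperbolic_mx_near cX codX aA) => B [_ ->].
have oH' : open H'.
  apply: (@open_grass R d m (fun A => avoids X A /\ ~ hyperbolic_mx X A)).
    move=> A B AB [aA nA]; split; first exact: avoids_eqmx AB aA.
    by move=> hB; apply: nA; apply: hyperbolic_mx_eqmx hB; exact: eqmx_sym.
  move=> A fA [aA nA]; apply: filterS (hyperbolic_mx_near cX codX aA) => B [aB hB].
  by split => // /hB.
have DH : D `&` H = D.
  apply: cD.
  - by exists V; split => //; apply/(hyperbolicP cX).
  - by exists H.
  - exists (~` H'); first exact: open_closedC.
    apply/seteqP; split => W [DW hW]; split => //; first by move=> [].
    by apply: contrapT => nW; apply: hW; split => //; exact: DA.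
by have [] : (D `&` H) V' by rewrite DH.
Qed.
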